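(* Let $d\ge 1$ and let $\ell(x)=\frac12\langle x,Mx\rangle-\langle q,x\rangle+c$ for $x\in\mathbb{R}^d$, where $M\in\mathbb{R}^{d\times d}$ is symmetric positive semidefinite, $q\in\operatorname{Span}M$ and $c\in\mathbb{R}$. Let $h\in\Gamma_0(\mathbb{R}^d)$ be such that $\operatorname{dom}h$ is closed. Let $w_0\in\operatorname{dom}\partial h^*\cap(\operatorname{ri}\operatorname{dom}h^*+\operatorname{Span}M)$. Then there exists a unique Lipschitz solution $w:\mathbb{R}_{\ge0}\to\mathbb{R}^d$ of the mirror flow with mirror potential $h$ and loss $\ell$ such that $w(0)=w_0$. Moreover, if $x$ is an associated primal variable, then for a.e. $t\ge0$, $$x(t)\in\operatorname*{Argmin}_{y\in\partial h^*(w(t))}\ell(y).$$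
   Context: $\Gamma_0(\mathbb{R}^d)$ is the set of proper, convex, lower semicontinuous functions $\mathbb{R}^d\to\mathbb{R}\cup\{+\infty\}$. $\operatorname{dom}f=\{f<+\infty\}$; $\partial f$ is the convex subdifferential; $\operatorname{dom}\partial f=\{x:\partial f(x)\ne\emptyset\}$; $f^*$ is the Fenchel conjugate; $\operatorname{ri}$ denotes relative interior; $\operatorname{Span}M$ is the column span of $M$; $\operatorname{Argmin}$ denotes the set of minimizers. Mirror flow: a function $w:\mathbb{R}_{\ge0}\to\mathbb{R}^d$ is a solution of the mirror flow with mirror potential $h$ and loss $\ell$ if there exists $x:\mathbb{R}_{\ge0}\to\mathbb{R}^d$ such that for a.e. $t\ge0$, $w$ is differentiable at $t$ and $\frac{\mathrm{d}w}{\mathrm{d}t}(t)=-\nabla\ell(x(t))$, $w(t)\in\partial h(x(t))$. Any such $x$ is called an associated primal variable. *)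

(* Defs.v *)
From HB Require Import structures.
From mathcomp Require Import all_boot all_order all_algebra.
From mathcomp Require Import all_classical all_reals all_analysis.
Set Implicit Arguments.
Unset Strict Implicit.
Unset Printing Implicit Defensive.
Import Order.TTheory GRing.Theory Num.Theory.
Import numFieldNormedType.Exports.
Local Open Scope classical_set_scope.
Local Open Scope ring_scope.

(* R^d is represented by row vectors. The library norm of 'rV[R]_d is the
   sup norm; it is only used through the topology and Lipschitz continuity,
   which are the same for all norms on R^d. Functions on the half-line t >= 0
   are represented by functions on R whose values at t < 0 are irrelevant. *)

Section ConvexAnalysis.
Context {R : realType} {d : nat}.
Local Notation V := 'rV[R]_d.
Implicit Types (f : V -> \bar R) (g : V -> R) (A C : set V) (x y v : V).

Definition dotp x y : R := \sum_(i < d) x ord0 i * y ord0 i.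

Definition edom f : set V := [set x | (f x < +oo)%E].

Definition proper_fun f : Prop :=
  (forall x, f x != -oo%E) /\ edom f !=set0.

Definition econvex f : Prop :=
  forall x y (t : R), 0 <= t <= 1 ->
    (f (t *: x + (1 - t) *: y)%R <= t%:E * f x + (1 - t)%R%:E * f y)%E.

Definition Gamma0 f : Prop :=
  [/\ proper_fun f, econvex f & lower_semicontinuous f].

Definition subdiff f x : set V :=
  [set v | forall y, (f x + (dotp v (y - x)%R)%:E <= f y)%E].

Definition dom_subdiff f : set V := [set x | subdiff f x !=set0].

Definition fenchel f : V -> \bar R :=
  fun v => ereal_sup [set ((dotp x v)%:E - f x)%E | x in [set: V]].

Definition affine_set A : Prop :=
  forall x y (t : R), A x -> A y -> A (t *: x + (1 - t) *: y).

Definition affine_hull C : set V := smallest affine_set C.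

Definition relint C : set V :=
  [set x | C x /\ \forall y \near within (affine_hull C) (nbhs x), C y].

Definition argmin_on A g : set V :=
  [set x | A x /\ forall y, A y -> g x <= g y].

Definition gradient g x : V := \row_(i < d) 'D_(delta_mx ord0 i) g x.

(* The column M x, as a row vector. *)
Definition mxapp (M : 'M[R]_d) x : V := x *m M^T.

Definition colspan (M : 'M[R]_d) : set V := range (mxapp M).

Definition sym_psd (M : 'M[R]_d) : Prop :=
  M^T = M /\ forall x, 0 <= dotp x (mxapp M x).

Definition quad_loss (M : 'M[R]_d) (q : V) (c : R) : V -> R :=
  fun x => 2^-1 * dotp x (mxapp M x) - dotp q x + c.

Definition primal_variable (h : V -> \bar R) (l : V -> R) (w x : R -> V) : Prop :=
  \forall t \ae (@lebesgue_measure R), 0 <= t ->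
    [/\ derivable w t 1, derive1 w t = - gradient l (x t) & subdiff h (x t) (w t)].

Definition mirror_flow (h : V -> \bar R) (l : V -> R) (w : R -> V) : Prop :=
  exists x : R -> V, primal_variable h l w x.

Definition lipschitz_mirror_flow_from
    (h : V -> \bar R) (l : V -> R) (w0 : V) (w : R -> V) : Prop :=
  [/\ [lipschitz w t | t in [set t : R | 0 <= t]], mirror_flow h l w & w 0 = w0].

End ConvexAnalysis.

(* Main.v *)
Require Import Defs.
From HB Require Import structures.
From mathcomp Require Import all_boot all_order all_algebra.
From mathcomp Require Import all_classical all_reals all_analysis.
From mathcomp Require Import ring lra.
Import Order.TTheory GRing.Theory Num.Theory.
Import numFieldNormedType.Exports.
Local Open Scope classical_set_scope.
Local Open Scope ring_scope.

(* Write M = B B^T and q = M p. Along a solution, w = w0 + u B^T where u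
   solves - u' in A u, and A is the monotone operator u |-> (x - p) B with
   x ranging over the subdifferential of h^* at w. The operator built from
   the inverse of the subdifferential of h is contained in A and has full
   resolvents: the regularized resolvent equations are solved by
   minimization, and the relative interior condition bounds their solutions
   as the regularization vanishes. So the two operators agree and are
   maximal monotone. The implicit Euler scheme then converges to a
   Lipschitz curve whose one-sided difference quotients only have limit
   points in - A u; the right derivative is the element of least norm,
   whose norm decreases in time, so that the curve is differentiable
   outside a countable set. The least norm property says that x minimizes
   the loss, since the loss of x is half the squared norm of (x - p) B up
   to a constant. *)

(** * Euclidean norm and limits *)

(** [M] may be singular, so it gives no metric on the whole space in which [w] evolves. Passing to
    [u] settles this: [B] and its transpose are adjoint, so pairing increments of [u] with
    increments of [(x - p) B] is the same as pairing increments of [w] with increments of [x], and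
    monotonicity holds for the usual inner product.

    Two operators are needed because a solution requires [w] in the subdifferential of [h] at [x],
    while the minimization concerns [x] in the subdifferential of the conjugate at [w]. The first
    gives the second by equality in Young's inequality; the converse comes from maximality.

    Uniqueness cannot be argued in [u], since an arbitrary competitor is not known to have the form
    [w0 + u B^T], and its derivative is known only almost everywhere. Hence [ae_nonincreasing],
    which recovers monotonicity of a Lipschitz function from the sign of its almost everywhere
    derivative. It is used twice: to keep the difference of two solutions in the span of [M], and
    then to show that a quadratic form, definite on that span, does not grow along it. *)

Section Euclid.
Set Implicit Arguments.
Unset Strict Implicit.
Context {R : realType}.

Lemma dotp_mxE n (x y : 'rV[R]_n) : dotp x y = (x *m y^T) ord0 ord0.
Proof. by rewrite mxE; apply: eq_bigr => i _; rewrite mxE. Qed.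

Lemma dotpC n (x y : 'rV[R]_n) : dotp x y = dotp y x.
Proof. by apply: eq_bigr => i _; rewrite mulrC. Qed.

Lemma dotpDl n (x y z : 'rV[R]_n) : dotp (x + y) z = dotp x z + dotp y z.
Proof. by rewrite -big_split; apply: eq_bigr => i _; rewrite mxE mulrDl. Qed.

Lemma dotpZl n (k : R) (x y : 'rV[R]_n) : dotp (k *: x) y = k * dotp x y.
Proof. by rewrite mulr_sumr; apply: eq_bigr => i _; rewrite mxE mulrA. Qed.

Lemma dotpNl n (x y : 'rV[R]_n) : dotp (- x) y = - dotp x y.
Proof. by rewrite -scaleN1r dotpZl mulN1r. Qed.

Lemma dotpBl n (x y z : 'rV[R]_n) : dotp (x - y) z = dotp x z - dotp y z.
Proof. by rewrite dotpDl dotpNl. Qed.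

Lemma dotpDr n (x y z : 'rV[R]_n) : dotp z (x + y) = dotp z x + dotp z y.
Proof. by rewrite !(dotpC z) dotpDl. Qed.

Lemma dotpZr n (k : R) (x y : 'rV[R]_n) : dotp y (k *: x) = k * dotp y x.
Proof. by rewrite !(dotpC y) dotpZl. Qed.

Lemma dotpNr n (x y : 'rV[R]_n) : dotp y (- x) = - dotp y x.
Proof. by rewrite !(dotpC y) dotpNl. Qed.

Lemma dotpBr n (x y z : 'rV[R]_n) : dotp z (x - y) = dotp z x - dotp z y.
Proof. by rewrite !(dotpC z) dotpBl. Qed.

Lemma dotp0l n (x : 'rV[R]_n) : dotp 0 x = 0.
Proof. by rewrite -(scale0r 0) dotpZl mul0r. Qed.

Lemma dotp0r n (x : 'rV[R]_n) : dotp x 0 = 0.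
Proof. by rewrite dotpC dotp0l. Qed.

Definition dotpE := (dotpDl, dotpDr, dotpBl, dotpBr, dotpZl, dotpZr, dotpNl,
  dotpNr, dotp0l, dotp0r).

Lemma dotp_mulmx m n (x : 'rV[R]_m) (A : 'M[R]_(m, n)) y :
  dotp (x *m A) y = dotp x (y *m A^T).
Proof. by rewrite !dotp_mxE trmx_mul trmxK mulmxA. Qed.

Lemma dotp_ge0 n (x : 'rV[R]_n) : 0 <= dotp x x.
Proof. by apply: sumr_ge0 => i _; rewrite -expr2 sqr_ge0. Qed.

Lemma dotp_eq0 n (x : 'rV[R]_n) : dotp x x = 0 -> x = 0.
Proof.
move=> /eqP; rewrite psumr_eq0; last by move=> i _; rewrite -expr2 sqr_ge0.
move=> /allP x0; apply/rowP => i; rewrite mxE; apply/eqP.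
by have := x0 i (mem_index_enum i); rewrite /= mulf_eq0 orbb.
Qed.

Definition enorm n (x : 'rV[R]_n) : R := Num.sqrt (dotp x x).

Lemma enorm_ge0 n (x : 'rV[R]_n) : 0 <= enorm x.
Proof. exact: sqrtr_ge0. Qed.

Lemma enorm_sqr n (x : 'rV[R]_n) : enorm x ^+ 2 = dotp x x.
Proof. by rewrite sqr_sqrtr// dotp_ge0. Qed.

Lemma enorm_le n (x : 'rV[R]_n) (r : R) :
  0 <= r -> (enorm x <= r) = (dotp x x <= r ^+ 2).
Proof.
by move=> r0; rewrite -enorm_sqr ler_pXn2r// nnegrE ?enorm_ge0.
Qed.

Lemma enorm0 n : enorm (0 : 'rV[R]_n) = 0.
Proof. by rewrite /enorm dotp0l sqrtr0. Qed.

Lemma enormN n (x : 'rV[R]_n) : enorm (- x) = enorm x.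
Proof. by rewrite /enorm dotpNl dotpNr opprK. Qed.

Lemma enormB n (x y : 'rV[R]_n) : enorm (x - y) = enorm (y - x).
Proof. by rewrite -enormN opprB. Qed.

Lemma enormZ n (k : R) (x : 'rV[R]_n) : enorm (k *: x) = `|k| * enorm x.
Proof.
by rewrite /enorm dotpZl dotpZr mulrA -expr2 sqrtrM ?sqr_ge0// sqrtr_sqr.
Qed.

Lemma cauchy_schwarz n (x y : 'rV[R]_n) : dotp x y <= enorm x * enorm y.
Proof.
have [->|y0] := eqVneq y 0; first by rewrite dotp0r mulr_ge0 ?enorm_ge0.
have yy : 0 < dotp y y.
  by rewrite lt_def dotp_ge0 andbT; apply: contra_neq y0 => /dotp_eq0.
have [xy0|xy0] := leP (dotp x y) 0.
  by apply: le_trans xy0 _; rewrite mulr_ge0 ?enorm_ge0.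
rewrite -(ler_pXn2r (n := 2))// ?nnegrE ?mulr_ge0 ?enorm_ge0//; last exact: ltW.
rewrite exprMn !enorm_sqr -subr_ge0 -(pmulr_rge0 _ yy).
have := dotp_ge0 (dotp y y *: x - dotp x y *: y).
rewrite !dotpE (dotpC y x); congr (_ <= _); ring.
Qed.

Lemma cauchy_schwarz_norm n (x y : 'rV[R]_n) :
  `|dotp x y| <= enorm x * enorm y.
Proof.
rewrite ler_norml cauchy_schwarz andbT lerNl -dotpNl -(enormN x).
exact: cauchy_schwarz.
Qed.

Lemma enormD n (x y : 'rV[R]_n) : enorm (x + y) <= enorm x + enorm y.
Proof.
rewrite enorm_le ?addr_ge0 ?enorm_ge0// !dotpE (dotpC y x).
have := cauchy_schwarz x y; rewrite sqrrD !enorm_sqr; lra.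
Qed.

Lemma enorm_dist n (x y z : 'rV[R]_n) :
  enorm (x - y) <= enorm (x - z) + enorm (z - y).
Proof. by rewrite -(subrKA z) enormD. Qed.

Lemma norm_le_enorm n (x : 'rV[R]_n) : `|x| <= enorm x.
Proof.
rewrite [leLHS]/Num.norm/= mx_normrE; apply: bigmax_le; first exact: enorm_ge0.
move=> [i j] _ /=; rewrite (ord1 i) -(ler_pXn2r (n := 2))// ?nnegrE ?enorm_ge0//.
rewrite enorm_sqr -normrX ger0_norm ?sqr_ge0//.
rewrite /dotp (bigD1 j)//= expr2 lerDl.
by apply: sumr_ge0 => k _; rewrite -expr2 sqr_ge0.
Qed.

Lemma enorm_le_norm n (x : 'rV[R]_n) : enorm x <= n%:R * `|x|.
Proof.
have xi i : `|x ord0 i| <= `|x|.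
  by rewrite [leRHS]/Num.norm/= mx_normrE; apply: (le_bigmax _ _ (ord0, i)).
have [n0|n0] := posnP n.
  by subst n; rewrite [x]thinmx0 enorm0 mul0r.
rewrite enorm_le ?mulr_ge0//.
have le1 i : x ord0 i * x ord0 i <= `|x| ^+ 2.
  by rewrite -expr2 -[x _ _ ^+ 2]ger0_norm ?sqr_ge0// normrX ler_pXn2r ?nnegrE.
rewrite /dotp; apply: (le_trans (ler_sum _ (fun i _ => le1 i))).
rewrite sumr_const card_ord -[leLHS]mulr_natl exprMn.
apply: ler_wpM2r; first exact: sqr_ge0.
by rewrite -natrX ler_nat -[leqLHS]muln1 expnS leq_mul2l expn1 n0 orbT.
Qed.

Lemma enorm_le_coord m (v : 'rV[R]_m) (T : R) : 0 <= T ->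
  (forall i, `|v ord0 i| <= T) -> enorm v <= m%:R * T.
Proof.
move=> T0 vT; apply: le_trans (enorm_le_norm _) _; rewrite ler_wpM2l//.
rewrite [leLHS]/Num.norm/= mx_normrE; apply: bigmax_le => // -[i j] _ /=.
by rewrite (ord1 i).
Qed.

Lemma dotp_row_mx m p (a b : 'rV[R]_m) (c e : 'rV[R]_p) :
  dotp (row_mx a c) (row_mx b e) = dotp a b + dotp c e.
Proof.
rewrite /dotp big_split_ord/=; congr (_ + _); apply: eq_bigr => i _;
  by rewrite !(row_mxEl, row_mxEr).
Qed.

Lemma enorm_row_mx m p (a : 'rV[R]_m) (c : 'rV[R]_p) :
  enorm (row_mx a c) <= enorm a + enorm c.
Proof.
rewrite enorm_le ?addr_ge0 ?enorm_ge0// dotp_row_mx -!enorm_sqr sqrrD.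
have : 0 <= enorm a * enorm c by rewrite mulr_ge0 ?enorm_ge0.
lra.
Qed.

Lemma cvg_enorm n (T : Type) (F : set_system T) (f : T -> 'rV[R]_n)
    (l : 'rV[R]_n) :
  Filter F -> f x @[x --> F] --> l <-> enorm (f x - l) @[x --> F] --> (0 : R).
Proof.
move=> FF; split=> [fl|].
  apply/cvgr0Pnorm_le => e e0.
  have n1 : 0 < n.+1%:R :> R by rewrite ltr0n.
  have en : 0 < e / n.+1%:R by rewrite divr_gt0.
  move/cvgrPdist_le : fl => /(_ _ en).
  apply: filterS => x fx; rewrite ger0_norm ?enorm_ge0// enormB.
  apply: le_trans (enorm_le_norm _) _; rewrite ler_pdivlMr// in fx.
  by apply: le_trans fx; rewrite mulrC ler_wpM2l// ler_nat.
move=> /cvgr0Pnorm_le fl; apply/cvgrPdist_le => e e0.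
apply: filterS (fl _ e0) => x; rewrite ger0_norm ?enorm_ge0//.
by apply: le_trans; rewrite distrC norm_le_enorm.
Qed.
End Euclid.

Section Limits.
Set Implicit Arguments.
Unset Strict Implicit.
Context {R : realType}.

Lemma cvg_dotp n (T : Type) (F : set_system T) (f g : T -> 'rV[R]_n)
    (x y : 'rV[R]_n) : Filter F ->
  f t @[t --> F] --> x -> g t @[t --> F] --> y ->
  dotp (f t) (g t) @[t --> F] --> dotp x y.
Proof.
move=> FF fx gy; rewrite /dotp.
apply: cvg_big => [|i _]; first exact: add_continuous.
have coordc (h : T -> 'rV[R]_n) (z : 'rV[R]_n) :
    h t @[t --> F] --> z -> h t ord0 i @[t --> F] --> z ord0 i.
  move=> hz; apply: (@cvg_comp _ _ _ h (fun v : 'rV[R]_n => v ord0 i) _ _ _ hz).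
  exact: (@coord_continuous R 1 n ord0 i z).
by apply: cvgM; exact: coordc.
Qed.

Lemma cvg_comp_enorm n (T : Type) (F : set_system T) (f : T -> 'rV[R]_n)
    (x : 'rV[R]_n) : Filter F ->
  f t @[t --> F] --> x -> enorm (f t) @[t --> F] --> enorm x.
Proof.
move=> FF fx.
apply: (@continuous_cvg _ _ _ _ _ _ Num.sqrt _ (@sqrt_continuous R _)).
exact: cvg_dotp.
Qed.

Lemma le_cvg_near (T : Type) (F : set_system T) (f g : T -> R) (l l' : R) :
  ProperFilter F -> f t @[t --> F] --> l -> g t @[t --> F] --> l' ->
  (\forall t \near F, f t <= g t) -> l <= l'.
Proof.
move=> FF fl gl fg; rewrite -subr_ge0.
have gfl : g t - f t @[t --> F] --> l' - l by exact: cvgB.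
by apply: cvgr_to_ge gfl _; apply: filterS fg => t; rewrite subr_ge0.
Qed.

Lemma enorm_mulmx_bound m n (A : 'M[R]_(m, n)) :
  exists2 C : R, 0 <= C & forall x, enorm (x *m A) <= C * enorm x.
Proof.
pose r j := enorm (row j A).
have rowE (x : 'rV[R]_m) : x *m A = \sum_j x ord0 j *: row j A.
  by rewrite mulmx_sum_row.
exists (\sum_j r j); first by apply: sumr_ge0 => j _; exact: enorm_ge0.
move=> x; rewrite rowE mulr_suml.
elim/big_ind2 : _ => [|a b c e ab ce|j _]; first by rewrite enorm0.
  by apply: le_trans (enormD _ _) _; rewrite lerD.
rewrite enormZ mulrC ler_wpM2l ?enorm_ge0//; apply: le_trans _ (norm_le_enorm _).
by rewrite [leRHS]/Num.norm/= mx_normrE; apply: (le_bigmax _ _ (ord0, j)).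
Qed.

(** On the row space [x = x *m pinvmx D *m D], so by adjointness the square of [enorm x] is a
    pairing of [x *m pinvmx D] with [x *m D^T]; Cauchy-Schwarz then loses only the norm of the
    pseudo-inverse. *)
Lemma enorm_row_space m n (D : 'M[R]_(m, n)) : exists2 C : R, 0 <= C &
  forall x : 'rV[R]_n, (x <= D)%MS -> enorm x <= C * enorm (x *m D^T).
Proof.
have [C C0 HC] := enorm_mulmx_bound (pinvmx D).
exists C => // x xD; have [->|xn0] := eqVneq (enorm x) 0.
  by rewrite mulr_ge0 ?enorm_ge0.
have x0 : 0 < enorm x by rewrite lt_def xn0 enorm_ge0.
rewrite -(ler_pM2l x0) -expr2 enorm_sqr -{1}(mulmxKpV xD) dotp_mulmx.
apply: le_trans (cauchy_schwarz _ _) _.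
by rewrite mulrA (mulrC (enorm x)) ler_wpM2r ?enorm_ge0.
Qed.

Lemma cvg_mulmxr m n (A : 'M[R]_(m, n)) (T : Type) (F : set_system T)
    (f : T -> 'rV[R]_m) (x : 'rV[R]_m) : Filter F ->
  f t @[t --> F] --> x -> f t *m A @[t --> F] --> x *m A.
Proof.
move=> FF /cvg_enorm fx; apply/cvg_enorm.
have [C C0 HC] := enorm_mulmx_bound A.
apply: (@squeeze_cvgr _ _ _ _ (fun=> 0) (fun t => C * enorm (f t - x))).
- by near=> t; rewrite enorm_ge0/= -mulmxBl HC.
- exact: cvg_cst.
- by rewrite -[X in _ --> X](mulr0 C); apply: cvgM => //; exact: cvg_cst.
Unshelve. all: by end_near. Qed.

Lemma compact_enorm_ball n (C : R) : compact [set x : 'rV[R]_n | enorm x <= C].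
Proof.
set K := (X in compact X); apply: bounded_closed_compact.
  exists C; split; first exact: num_real.
  by move=> M CM x Kx; apply: le_trans (norm_le_enorm _) (le_trans Kx (ltW CM)).
have -> : K = @enorm R n @^-1` [set r | r <= C] by [].
apply: closed_comp; last exact: closed_le.
by move=> x _; apply: (@cvg_comp_enorm _ _ (nbhs x) id x).
Qed.

Lemma ultra_bounded_cvg n (T : Type) (G : set_system T) (f : T -> 'rV[R]_n)
    (C : R) : UltraFilter G -> G [set t | enorm (f t) <= C] ->
  exists p : 'rV[R]_n, f t @[t --> G] --> p.
Proof.
move=> GU Gf.
have cK : compact [set x : 'rV[R]_n | enorm x <= C] by exact: compact_enorm_ball.
have [p [_ clp]] := cK (f t @[t --> G]) _ Gf.
exists p => W pW.
have [//|GW] := in_ultra_setVsetC (f @^-1` W) GU.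
have [x [nWx Wx]] := clp _ _ (GW : (f t @[t --> G]) (~` W)) pW.
by case: nWx.
Qed.

(** If some neighbourhood of [l] were missed, [F] restricted to the bad set would be proper and
    extend to an ultrafilter contradicting the hypothesis. With [ultra_bounded_cvg], it suffices to
    identify every limit point. *)
Lemma cvg_along_ultra (T : Type) (U : topologicalType) (F : set_system T)
    (f : T -> U) (l : U) : Filter F ->
  (forall G : set_system T, UltraFilter G -> F `<=` G -> f t @[t --> G] --> l) ->
  f t @[t --> F] --> l.
Proof.
move=> FF fG W lW; apply: contrapT => nFW.
have PF : ProperFilter (within (~` (f @^-1` W)) F).
  split; last exact: within_filter.
  rewrite /within/= => FW; apply: nFW.
  by apply: (filterS _ FW) => t /= Wt; apply: contrapT => /Wt.
have [G [GU FG]] := ultraFilterLemma PF.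
have GnW : G (~` (f @^-1` W)) by apply: FG; exact: withinT.
have GW : G (f @^-1` W).
  apply: fG lW => A FA; apply: FG; apply: filterS FA => t At _; exact: At.
by have [t [Wt]] := filter_ex (filterI GW GnW).
Qed.

End Limits.

(** * Evolution by a maximal monotone operator *)

Section MonotoneFlow.
Set Implicit Arguments.
Unset Strict Implicit.
Context {R : realType} {n : nat}.
Local Notation V := 'rV[R]_n.
Implicit Types (A : V -> V -> Prop) (x y z u a b : V).

Definition monotone_op A : Prop :=
  forall x a y b, A x a -> A y b -> 0 <= dotp (a - b) (x - y).

Definition resolvable A : Prop :=
  forall (k : R) u, 0 < k -> exists z a, A z a /\ z + k *: a = u.

(** Minty's argument: the resolvent of [u + a] is a point [z] of the graph with [a - b = - (u - z)],
    and testing the hypothesis there gives [u = z]. *)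
Lemma monotone_maximal A u a : resolvable A ->
  (forall y b, A y b -> 0 <= dotp (a - b) (u - y)) -> A u a.
Proof.
move=> rA Aua; have [z [b [Azb zbE]]] := rA 1 (u + a) ltr01.
have abE : a - b = - (u - z).
  have -> : b = u + a - z by rewrite -zbE scale1r addrC addKr.
  by apply/rowP => i; rewrite !mxE; ring.
have uz : u = z.
  apply/subr0_eq/dotp_eq0/eqP; rewrite eq_le dotp_ge0 andbT -oppr_ge0 -dotpNl.
  by rewrite -abE Aua.
by move: abE; rewrite uz subrr oppr0 => /subr0_eq ->.
Qed.

Definition least_norm_at A u a : Prop :=
  A u a /\ forall b, A u b -> enorm a <= enorm b.

(** By maximality [A u] is an intersection of half-spaces, hence contains the midpoint; the
    parallelogram identity concludes. *)
Lemma least_norm_unique A u a b : monotone_op A -> resolvable A ->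
  least_norm_at A u a -> least_norm_at A u b -> a = b.
Proof.
move=> mA rA [Aa mina] [Ab minb].
pose m := 2^-1 *: (a + b).
have Am : A u m.
  apply: monotone_maximal => // y c Ac.
  have := mA _ _ _ _ Aa Ac; have := mA _ _ _ _ Ab Ac.
  rewrite /m !(dotpDl, dotpNl, dotpZl); lra.
have := minb _ Aa; have := mina _ Ab; have := mina _ Am.
rewrite !enorm_le ?enorm_ge0// !enorm_sqr /m !dotpE (dotpC b a) => h1 h2 h3.
apply/subr0_eq/dotp_eq0/eqP; rewrite eq_le dotp_ge0 andbT.
rewrite !dotpE (dotpC b a); lra.
Qed.

Definition resolvent A (k : R) z : V :=
  xget 0 [set z' | A z' (k^-1 *: (z - z'))].

Section Resolvent.
Variables (A : V -> V -> Prop) (k : R).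
Hypotheses (mA : monotone_op A) (rA : resolvable A) (k0 : 0 < k).
Local Notation J := (resolvent A k).

Lemma resolventP z : A (J z) (k^-1 *: (z - J z)).
Proof.
rewrite /resolvent; case: xgetP => //= noz.
have [z' [a [Aza zE]]] := rA z k0.
case: (noz z'); rewrite /= -zE addrC addKr scalerA mulVf ?gt_eqF// scale1r.
exact: Aza.
Qed.

(** Expand the squared distance from [z] to [y] around [J z] and drop the square of [z - J z]. This
    form of one Euler step mentions no derivative, so it survives the passage to the limit. *)
Lemma resolvent_evi z y b : A y b ->
  dotp (J z - y) (J z - y) - dotp (z - y) (z - y) <= 2 * k * dotp b (y - J z).
Proof.
move=> Ab; have := mA (resolventP z) Ab.
rewrite -(pmulr_rge0 _ k0) !(dotpDl, dotpNl, dotpZl) mulrDr mulrA mulfV ?gt_eqF//.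
have := dotp_ge0 (z - J z).
rewrite !dotpE (dotpC y z) (dotpC (J z) z) (dotpC (J z) y).
lra.
Qed.

Lemma resolvent_nonexp z y : enorm (J z - J y) <= enorm (z - y).
Proof.
have := mA (resolventP z) (resolventP y).
rewrite -scalerBr dotpZl pmulr_rge0 ?invr_gt0//.
have -> : z - J z - (y - J y) = (z - y) - (J z - J y).
  by apply/rowP => i; rewrite !mxE; ring.
rewrite dotpBl -enorm_sqr subr_ge0 => H.
have := le_trans H (cauchy_schwarz _ _).
have [->|p0] := eqVneq (enorm (J z - J y)) 0; first by rewrite enorm_ge0.
by rewrite expr2 ler_pM2r// lt_def p0 enorm_ge0.
Qed.

Lemma resolvent_step y b : A y b -> enorm (J y - y) <= k * enorm b.
Proof.
move=> Ab; have := cauchy_schwarz b (y - J y).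
rewrite -(ler_pM2l k0) enormB => CS.
have [->|p0] := eqVneq (enorm (J y - y)) 0.
  by rewrite mulr_ge0 ?enorm_ge0 ?ltW.
have {}p0 : 0 < enorm (J y - y) by rewrite lt_def p0 enorm_ge0.
have := mA (resolventP y) Ab.
rewrite dotpBl dotpZl -(pmulr_rge0 _ k0) mulrBr mulrA mulfV ?gt_eqF//.
have -> : dotp (y - J y) (J y - y) = - enorm (J y - y) ^+ 2.
  by rewrite enorm_sqr -dotpNl opprB.
have -> : dotp b (J y - y) = - dotp b (y - J y) by rewrite -dotpNr opprB.
by move=> H; rewrite -(ler_pM2r p0); lra.
Qed.

Lemma iter_resolvent_nonexp m z y :
  enorm (iter m J z - iter m J y) <= enorm (z - y).
Proof.
by elim: m => //= m IH; apply: le_trans (resolvent_nonexp _ _) IH.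
Qed.

Lemma iter_resolvent_step j m y b : A y b ->
  enorm (iter (j + m) J y - iter m J y) <= j%:R * k * enorm b.
Proof.
move=> Ab; rewrite addnC iterD; apply: le_trans (iter_resolvent_nonexp _ _ _) _.
elim: j => [|j IH]; first by rewrite subrr enorm0 !mul0r.
rewrite iterSr; apply: le_trans (enorm_dist _ _ (iter j J y)) _.
apply: le_trans (lerD (le_trans (iter_resolvent_nonexp _ _ _) _) IH) _.
  exact: resolvent_step Ab.
by rewrite -natr1; lra.
Qed.

(** Sum of the one-step inequalities with the pairing frozen at the starting point [z];
    [enorm b * D] pays for the freezing. *)
Lemma iter_resolvent_evi m z y b (D : R) : A y b ->
  (forall i, (i <= m)%N -> enorm (iter i J z - z) <= D) ->
  dotp (iter m J z - y) (iter m J z - y) - dotp (z - y) (z - y)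
    <= 2 * (m%:R * k) * (dotp b (y - z) + enorm b * D).
Proof.
move=> Ab; elim: m => [|m IH] HD; first by rewrite /= subrr !mul0r mulr0 mul0r.
have := IH (fun i im => HD i (leqW im)).
have := resolvent_evi (iter m J z) Ab; rewrite -iterS.
have -> : y - iter m.+1 J z = (y - z) + (z - iter m.+1 J z).
  by rewrite addrA subrK.
rewrite (dotpDr _ _ b); set w := iter m.+1 J z; set v := iter m J z => H1 H2.
have H3 : dotp b (z - w) <= enorm b * D.
  apply: le_trans (cauchy_schwarz _ _) _; rewrite ler_wpM2l ?enorm_ge0//.
  by rewrite enormB HD.
have H4 : 2 * k * (dotp b (y - z) + dotp b (z - w))
    <= 2 * k * (dotp b (y - z) + enorm b * D).
  by rewrite ler_pM2l ?mulr_gt0// lerD2l.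
rewrite -natr1; lra.
Qed.

End Resolvent.

End MonotoneFlow.

(** * Limit of the implicit Euler curves *)

Section EulerLimit.
Set Implicit Arguments.
Unset Strict Implicit.
Context {R : realType} {n : nat}.
Local Notation V := 'rV[R]_n.
Variables (A : V -> V -> Prop) (u0 b0 : V).
Hypotheses (mA : monotone_op A) (rA : resolvable A) (Au0 : A u0 b0).

Let steps (N : nat) (t : R) : nat := Num.truncn (t * N.+1%:R).
Let J (N : nat) : V -> V := resolvent A N.+1%:R^-1.
Let euler (N : nat) (t : R) : V := iter (steps N t) (J N) u0.

Let step_gt0 (N : nat) : 0 < N.+1%:R^-1 :> R.
Proof. by rewrite invr_gt0. Qed.

Let cvg_steps (t : R) : 0 <= t -> (steps N t)%:R * N.+1%:R^-1 @[N --> \oo] --> t.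
Proof.
move=> t0; apply: (@squeeze_cvgr _ _ _ _ (fun N => t - N.+1%:R^-1) (fun=> t)).
- near=> N.
  have N0 : 0 < N.+1%:R :> R by [].
  have /truncn_itv/andP[h1 h2] : 0 <= t * N.+1%:R by rewrite mulr_ge0.
  apply/andP; split; last by rewrite ler_pdivrMr.
  rewrite lerBlDr -[X in _ + X]mul1r -mulrDl ler_pdivlMr// natr1; exact: ltW.
- by rewrite -[X in _ --> X]subr0; apply: cvgB; [exact: cvg_cst|exact: cvg_harmonic].
- exact: cvg_cst.
Unshelve. all: by end_near. Qed.

Let steps_le N s t : s <= t -> (steps N s <= steps N t)%N.
Proof. by move=> st; apply: le_truncn; rewrite ler_wpM2r. Qed.

Let eulerE N s t : s <= t ->
  euler N t = iter (steps N t - steps N s) (J N) (euler N s).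
Proof. by move=> st; rewrite -iterD subnK// steps_le. Qed.

Let elapsed N s t : R := (steps N t - steps N s)%:R * N.+1%:R^-1.

Let cvg_elapsed (s t : R) : 0 <= s -> s <= t -> elapsed N s t @[N --> \oo] --> t - s.
Proof.
move=> s0 st.
rewrite (_ : (fun N => elapsed N s t) = fun N =>
    (steps N t)%:R * N.+1%:R^-1 - (steps N s)%:R * N.+1%:R^-1).
  by apply: cvgB; apply: cvg_steps => //; exact: le_trans st.
by apply/funext => N; rewrite /elapsed natrB ?steps_le// mulrBl.
Qed.

(** Truncation sends negative reals to 0, so the curves rest at [u0] for negative times. They are
    thus bounded at every real [t], as the choice of limits in [euler_limit] requires. *)
Let steps_neg N (t : R) : t <= 0 -> steps N t = 0%N.
Proof.
move=> t0; apply/eqP; rewrite -leqn0 truncn_le_nat.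
by apply: le_lt_trans ltr01; rewrite mulr_le0_ge0.
Qed.

Let euler_bound N t : enorm (euler N t) <= enorm u0 + `|t| * enorm b0.
Proof.
have := enorm_dist (euler N t) 0 u0; rewrite !subr0 addrC => H.
apply: le_trans H _; rewrite lerD2l.
have [t0|t0] := leP t 0.
  by rewrite /euler steps_neg//= subrr enorm0 mulr_ge0 ?enorm_ge0.
have := iter_resolvent_step mA rA (step_gt0 N) (steps N t) 0 Au0.
rewrite addn0 => /le_trans; apply; rewrite ler_wpM2r ?enorm_ge0//.
rewrite gtr0_norm// ler_pdivrMr//.
by have /truncn_itv/andP[] : 0 <= t * N.+1%:R by rewrite mulr_ge0// ltW.
Qed.

(** Compares the iterates started at [euler N s] with those started at a point [y] where a value [b]
    of [A] is known. In the limit [y] is [u s], and the two distances to [y] vanish. *)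
Let euler_dist N s t t' y b : s <= t -> t <= t' -> A y b ->
  enorm (euler N t' - euler N t)
    <= enorm (euler N s - y) + enorm (euler N s - y) + elapsed N t t' * enorm b.
Proof.
move=> st tt' Ab; rewrite (eulerE N tt') (eulerE N st) -iterD.
set z := euler N s; set i := (steps N t - steps N s)%N.
set j := (steps N t' - steps N t)%N.
have h1 := iter_resolvent_nonexp mA rA (step_gt0 N) (j + i) z y.
have h2 := iter_resolvent_nonexp mA rA (step_gt0 N) i z y.
have h3 := iter_resolvent_step mA rA (step_gt0 N) j i Ab.
apply: le_trans (enorm_dist _ _ (iter (j + i) (J N) y)) _.
rewrite -addrA lerD//.
apply: le_trans (enorm_dist _ _ (iter i (J N) y)) _.
by rewrite addrC lerD// enormB.
Qed.

Let euler_evi N s t y b : s <= t -> A y b ->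
  dotp (euler N t - y) (euler N t - y) - dotp (euler N s - y) (euler N s - y)
    <= 2 * elapsed N s t *
       (dotp b (y - euler N s) + enorm b * (elapsed N s t * enorm b0)).
Proof.
move=> st Ab; rewrite (eulerE N st).
apply: (iter_resolvent_evi mA rA (step_gt0 N)) => // i im.
rewrite -iterD.
apply: le_trans (iter_resolvent_step mA rA (step_gt0 N) _ _ Au0) _.
by rewrite ler_wpM2r ?enorm_ge0// ler_wpM2r// ler_nat.
Qed.

(* The limit of the Euler curves is taken along an ultrafilter, which replaces
   the Arzela-Ascoli extraction of a subsequence. *)
Lemma euler_limit : exists u : R -> V, [/\ u 0 = u0,
  forall s t t' b, 0 <= s -> s <= t -> t <= t' -> A (u s) b ->
    enorm (u t' - u t) <= (t' - t) * enorm b &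
  forall s t y b, 0 <= s -> s <= t -> A y b ->
    dotp (u t - y) (u t - y) - dotp (u s - y) (u s - y)
      <= 2 * (t - s) * (dotp b (y - u s) + enorm b * ((t - s) * enorm b0))].
Proof.
have [G [GU ooG]] := ultraFilterLemma (@eventually_filter).
have /choice[u uP] : forall t, exists p : V, euler N t @[N --> G] --> p.
  move=> t; apply: (ultra_bounded_cvg (C := enorm u0 + `|t| * enorm b0)).
  by apply: filterE => N; exact: euler_bound.
have cvgG (f : nat -> R) (l : R) :
    f N @[N --> \oo] --> l -> f N @[N --> G] --> l.
  by move=> fl; apply: cvg_trans fl => W; exact: ooG.
exists u; split.
- have h : euler N 0 @[N --> G] --> u0.
    rewrite (_ : euler^~ 0 = fun=> u0); first exact: cvg_cst.
    by apply/funext => N; rewrite /euler steps_neg.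
  by apply: cvg_unique (uP 0) h; exact: norm_hausdorff.
- move=> s t t' b s0 st tt' Ab.
  have t0 := le_trans s0 st.
  have hl : enorm (euler N t' - euler N t) @[N --> G] --> enorm (u t' - u t).
    by apply: cvg_comp_enorm; exact: cvgB.
  have hs : enorm (euler N s - u s) @[N --> G] --> (0 : R).
    exact/cvg_enorm.
  have he := cvgG _ _ (cvg_elapsed t0 tt').
  apply: (@le_cvg_near _ _ _ _ (fun N => enorm (euler N s - u s)
    + enorm (euler N s - u s) + elapsed N t t' * enorm b) _ _ _ hl).
    rewrite -[X in _ --> X]add0r -[X in _ --> X + _](addr0 0).
    by apply: cvgD; [exact: cvgD|apply: cvgM => //; exact: cvg_cst].
  by apply: filterE => N; exact: euler_dist.
- move=> s t y b s0 st Ab.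
  have hy r : euler N r - y @[N --> G] --> u r - y.
    by apply: cvgB; [exact: uP|exact: cvg_cst].
  have he := cvgG _ _ (cvg_elapsed s0 st).
  have hb : dotp b (y - euler N s) @[N --> G] --> dotp b (y - u s).
    by apply: cvg_dotp; [exact: cvg_cst|apply: cvgB; [exact: cvg_cst|exact: uP]].
  apply: (@le_cvg_near _ _ G
    (fun N => dotp (euler N t - y) (euler N t - y)
              - dotp (euler N s - y) (euler N s - y))
    (fun N => 2 * elapsed N s t *
       (dotp b (y - euler N s) + enorm b * (elapsed N s t * enorm b0)))).
  + have hd r : dotp (euler N r - y) (euler N r - y) @[N --> G] -->
        dotp (u r - y) (u r - y) by exact: cvg_dotp.
    exact: cvgB.
  + have h2 : 2 * elapsed N s t @[N --> G] --> 2 * (t - s).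
      by apply: cvgM => //; exact: cvg_cst.
    apply: cvgM => //; apply: cvgD => //.
    apply: (@cvgM _ _ _ _ (fun=> enorm b)); first exact: cvg_cst.
    by apply: cvgM => //; exact: cvg_cst.
  + by apply: filterE => N; exact: euler_evi.
Qed.

End EulerLimit.

(** * One-sided and two-sided derivatives of the limit curve *)

Section CurveDerivative.
Set Implicit Arguments.
Unset Strict Implicit.
Context {R : realType} {n : nat}.
Local Notation V := 'rV[R]_n.
Variables (A : V -> V -> Prop) (u : R -> V) (b0 : V).
Hypotheses (mA : monotone_op A) (rA : resolvable A) (Au0 : A (u 0) b0).
Hypothesis u_lip : forall s t t' b, 0 <= s -> s <= t -> t <= t' -> A (u s) b ->
  enorm (u t' - u t) <= (t' - t) * enorm b.
Hypothesis u_evi : forall s t y b, 0 <= s -> s <= t -> A y b ->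
  dotp (u t - y) (u t - y) - dotp (u s - y) (u s - y)
    <= 2 * (t - s) * (dotp b (y - u s) + enorm b * ((t - s) * enorm b0)).

Let quot t h : V := h^-1 *: (u (t + h) - u t).

Let quotK t h : h != 0 -> u (t + h) = u t + h *: quot t h.
Proof. by move=> h0; rewrite /quot scalerA mulfV// scale1r [RHS]addrC subrK. Qed.

Let quot_bound s t h b : 0 <= s -> s <= t -> s <= t + h -> h != 0 ->
  A (u s) b -> enorm (quot t h) <= enorm b.
Proof.
move=> s0 st sth h0 Ab; rewrite /quot enormZ normfV ler_pdivrMl ?normr_gt0//.
have [hn|hp|hE] := ltgtP h 0; last by rewrite hE eqxx in h0.
  rewrite ltr0_norm// enormB; apply: le_trans (u_lip s0 sth _ Ab) _; first lra.
  by rewrite opprD addrA subrr add0r.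
rewrite gtr0_norm//; apply: le_trans (u_lip s0 st _ Ab) _; first lra.
by rewrite addrAC subrr add0r.
Qed.

(** The backward case dictates the constant. The error of [u_evi] and the shift of the pairing from
    [u (t + h)] to [u t] cost [2 * (enorm b * enorm b0)] each; the square of the quotient costs
    [enorm b0 ^+ 2]. *)
Let quot_evi t h y b : 0 <= t -> 0 <= t + h -> h != 0 -> A y b ->
  2 * dotp (quot t h) (u t - y) <= 2 * dotp b (y - u t)
    + (4 * (enorm b * enorm b0) + enorm b0 ^+ 2) * `|h|.
Proof.
move=> t0 th h0 Ab; have qb := quot_bound (lexx 0) t0 th h0 Au0.
have q2 : dotp (quot t h) (quot t h) <= enorm b0 ^+ 2.
  by rewrite -enorm_le ?enorm_ge0.
have uth := quotK t h0; set q := quot t h in qb q2 uth *; clearbody q.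
have bq : `|dotp b q| <= enorm b * enorm b0.
  by apply: le_trans (cauchy_schwarz_norm _ _) _; rewrite ler_wpM2l ?enorm_ge0.
have hh : 0 <= h * h by rewrite -expr2 sqr_ge0.
have bb : 0 <= enorm b * enorm b0 by rewrite mulr_ge0 ?enorm_ge0.
have [hn|hp|hE] := ltgtP h 0; last by rewrite hE eqxx in h0.
  have tht : t + h <= t by lra.
  have := u_evi th tht Ab.
  have -> : t - (t + h) = - h by ring.
  have -> : y - u (t + h) = (y - u t) - h *: q.
    by rewrite uth opprD addrA.
  have -> : u (t + h) - y = (u t - y) + h *: q by rewrite uth addrAC.
  rewrite ltr0_norm//; move: bq; rewrite ler_norml => /andP[bq1 bq2] H.
  have hn' : 0 < - h by rewrite oppr_gt0.
  rewrite -(ler_pM2l hn'); move: H.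
  rewrite -(opprB (u t) y); move: (u t - y) => z.
  rewrite !dotpE (dotpC z q) => H.
  have h1 : h * h * dotp q q <= h * h * enorm b0 ^+ 2.
    by rewrite ler_wpM2l.
  have h2 : h * h * (- dotp b q) <= h * h * (enorm b * enorm b0).
    by apply: ler_wpM2l => //; lra.
  have h3 : h * h * dotp b q <= h * h * (enorm b * enorm b0).
    by rewrite ler_wpM2l.
  have h4 : 0 <= h * h * (enorm b * enorm b0).
    exact: mulr_ge0.
  lra.
have tth : t <= t + h by lra.
have := u_evi t0 tth Ab.
have -> : t + h - t = h by ring.
have -> : u (t + h) - y = (u t - y) + h *: q by rewrite uth addrAC.
rewrite gtr0_norm// => H; rewrite -(ler_pM2l hp); move: H.
rewrite -(opprB (u t) y); move: (u t - y) => z.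
rewrite !dotpE (dotpC z q) => H.
have h1 : 0 <= h * h * dotp q q by rewrite mulr_ge0 ?dotp_ge0.
have h4 : 0 <= h * h * (enorm b * enorm b0).
  exact: mulr_ge0.
have h5 : 0 <= h * h * enorm b0 ^+ 2.
  by rewrite mulr_ge0 ?sqr_ge0.
lra.
Qed.
(** The error in [quot_evi] vanishes with [h], leaving the inequality that maximality turns into
    membership. In particular [u t] lies in the domain of [A], which the limit of the scheme does
    not give by itself. *)
Let limit_quot t (G : set_system R) (v : V) : ProperFilter G -> 0 <= t ->
  h @[h --> G] --> (0 : R) -> G [set h : R | h != 0 /\ 0 <= t + h] ->
  quot t h @[h --> G] --> v -> A (u t) (- v).
Proof.
move=> GP t0 G0 Gh qv; apply: monotone_maximal => // y b Ab.
pose K : R := 4 * (enorm b * enorm b0) + enorm b0 ^+ 2.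
have h1 : 2 * dotp (quot t h) (u t - y) @[h --> G] --> 2 * dotp v (u t - y).
  apply: (@cvgM _ _ _ _ (fun=> 2)); first exact: cvg_cst.
  by apply: cvg_dotp => //; exact: cvg_cst.
have h2 : 2 * dotp b (y - u t) + K * `|h| @[h --> G]
    --> 2 * dotp b (y - u t) + K * `|0 : R|.
  apply: cvgD; first exact: cvg_cst.
  by apply: (@cvgM _ _ _ _ (fun=> K)); [exact: cvg_cst|exact: cvg_norm].
have : 2 * dotp v (u t - y) <= 2 * dotp b (y - u t) + K * `|0 : R|.
  apply: le_cvg_near h1 h2 _.
  by apply: filterS Gh => h [h0 th]; exact: quot_evi.
rewrite normr0 mulr0 addr0 -(opprB (u t) y) dotpNr dotpBl dotpNl; lra.
Qed.

Let right_quot s t b : 0 <= s -> s <= t -> A (u s) b ->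
  exists a, A (u t) a /\ enorm a <= enorm b /\
    exists G : set_system R, [/\ ProperFilter G, G [set h : R | 0 < h] &
      quot t h @[h --> G] --> - a].
Proof.
move=> s0 st Ab; have t0 := le_trans s0 st.
have [G [GU sG]] := ultraFilterLemma (at_right_proper_filter (0 : R)).
have Gpos : G [set h : R | 0 < h] by apply: sG; exact: nbhs_right_gt.
have Gb : G [set h : R | enorm (quot t h) <= enorm b].
  apply: filterS Gpos => h /= h0.
  by apply: (@quot_bound s) => //; [rewrite ler_wpDr// ltW|rewrite gt_eqF].
have [v qv] := ultra_bounded_cvg GU Gb.
exists (- v); split; last split.
- apply: (limit_quot _ t0 _ _ qv).
    by apply: cvg_trans (@cvg_within _ (nbhs (0 : R)) _ _) => W; exact: sG.
  apply: filterS Gpos => h /= h0; rewrite gt_eqF//; split=> //.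
  by rewrite addr_ge0// ltW.
- rewrite enormN; apply: (le_cvg_near _ (cvg_comp_enorm _ qv)).
    exact: cvg_cst.
  exact: Gb.
- by exists G; split; [exact: ultra_proper|exact: Gpos|rewrite opprK].
Qed.

(** Restarting the speed bound at [t] itself bounds the forward quotients by the norm of every
    element of [A (u t)], hence so is their limit point, which belongs to [A (u t)]. *)
Lemma curve_least_norm s t b : 0 <= s -> s <= t -> A (u s) b ->
  exists a, least_norm_at A (u t) a /\ enorm a <= enorm b.
Proof.
move=> s0 st Ab; have t0 := le_trans s0 st.
have [a [Aa [ab [G [GP Gpos qa]]]]] := right_quot s0 st Ab.
exists a; split=> //; split=> // c Ac.
rewrite -enormN; apply: (le_cvg_near _ (cvg_comp_enorm _ qa)).
  exact: cvg_cst.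
apply: filterS Gpos => h /= h0.
by apply: (@quot_bound t) => //; [rewrite ler_wpDr// ltW|rewrite gt_eqF].
Qed.

(* At a time where the least norm is left-continuous, the backward quotients
   cannot have a limit point of larger norm than the forward ones. *)
Lemma curve_derivative t a : 0 < t -> least_norm_at A (u t) a ->
  (forall e, 0 < e -> exists s b, [/\ 0 <= s, s < t, A (u s) b &
     enorm b <= enorm a + e]) ->
  h^-1 *: (u (t + h) - u t) @[h --> (0 : R)^'] --> - a.
Proof.
move=> t0 mina left_cont; apply: cvg_along_ultra => G GU sG.
have Gn0 : G [set h : R | h != 0] by apply: sG; exact: withinT.
have G0 : h @[h --> G] --> (0 : R).
  by apply: cvg_trans (@cvg_within _ (nbhs (0 : R)) _ _) => W; exact: sG.
have Gs s : s < t -> G [set h : R | s <= t + h].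
  move=> st; have st0 : 0 < t - s by rewrite subr_gt0.
  have Gh : G [set h : R | `|h| <= t - s] by exact: (cvgr0_norm_le _ G0).
  apply: filterS Gh => h /=.
  rewrite ler_norml; lra.
have Gb s b : 0 <= s -> s < t -> A (u s) b ->
    G [set h : R | enorm (quot t h) <= enorm b].
  move=> s0 st Ab; apply: filterS2 Gn0 (Gs _ st) => h h0 sth.
  exact: quot_bound (ltW st) _ _ Ab.
have [v qv] := ultra_bounded_cvg GU (Gb _ _ (lexx 0) t0 Au0).
have Av : A (u t) (- v).
  apply: (limit_quot _ (ltW t0) G0 _ qv).
  by apply: filterS2 Gn0 (Gs _ t0).
(* Near [t] the quotients of both signs are bounded by the norm of any [b] in [A (u s)] with
   [s < t]; left continuity brings this bound down to [enorm a]. *)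
have va : enorm (- v) <= enorm a.
  apply/ler_addgt0Pr => e /left_cont[s [b [s0 st Ab ba]]].
  apply: le_trans ba; rewrite enormN.
  apply: (le_cvg_near _ (cvg_comp_enorm _ qv)); first exact: cvg_cst.
  exact: Gb Ab.
have minv : least_norm_at A (u t) (- v).
  by split=> // c Ac; apply: le_trans va _; exact: mina.2.
by rewrite (least_norm_unique mA rA mina minv) opprK.
Qed.

End CurveDerivative.

Section MonotoneFlowExistence.
Set Implicit Arguments.
Unset Strict Implicit.
Context {R : realType}.

(** Pick a rational in each jump. Since [N] is nonincreasing, jumps at distinct times occupy
    disjoint ranges, so the choice is injective. *)
Lemma countable_left_jumps (N : R -> R) :
  (forall s t, 0 <= s -> s <= t -> N t <= N s) ->
  countable [set t | 0 <= t /\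
    exists2 e, 0 < e & forall s, 0 <= s -> s < t -> N t + e <= N s].
Proof.
move=> Nmono; set D := (X in countable X).
have /choice[r rP] : forall t, exists r : rat, D t ->
    N t < ratr r /\ forall s, 0 <= s -> s < t -> ratr r < N s.
  move=> t; have [[t0 [e e0 He]]|nD] := pselect (D t); last by exists 0.
  have /rat_in_itvoo[r] : N t < N t + e by rewrite ltrDl.
  rewrite in_itv/= => /andP[r1 r2]; exists r => _; split=> // s s0 st.
  exact: lt_le_trans r2 (He _ s0 st).
apply/countable_injP; exists (pickle \o r) => s t /set_mem Ds /set_mem Dt /=.
move=> /(pcan_inj pickleK) rst; apply/eqP; rewrite eq_le.
have [rs1 rs2] := rP _ Ds; have [rt1 rt2] := rP _ Dt.
apply/andP; split; rewrite leNgt; apply/negP => lt_st.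
  by have := rs2 _ Dt.1 lt_st; rewrite rst => /(lt_trans rt1); rewrite ltxx.
by have := rt2 _ Ds.1 lt_st; rewrite -rst => /(lt_trans rs1); rewrite ltxx.
Qed.

Theorem monotone_flow (n : nat) (A : 'rV[R]_n -> 'rV[R]_n -> Prop)
    (u0 b0 : 'rV[R]_n) : monotone_op A -> resolvable A -> A u0 b0 ->
  exists u : R -> 'rV[R]_n, [/\ u 0 = u0,
    forall s t, 0 <= s -> s <= t -> enorm (u t - u s) <= (t - s) * enorm b0 &
    exists2 D : set R, countable D & forall t, 0 < t -> ~ D t ->
      exists2 a, least_norm_at A (u t) a &
        h^-1 *: (u (t + h) - u t) @[h --> (0 : R)^'] --> - a].
Proof.
move=> mA rA Au0; have [u [uE u_lip u_evi]] := euler_limit mA rA Au0.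
rewrite -uE in Au0.
exists u; split=> // [s t s0 st|]; first exact: u_lip Au0.
have /choice[a aP] : forall t, exists a, 0 <= t -> least_norm_at A (u t) a.
  move=> t; have [t0|_] := leP 0 t; last by exists 0.
  have [a [Ha _]] := curve_least_norm rA Au0 u_lip u_evi (lexx 0) t0 Au0.
  by exists a.
pose N t := enorm (a t).
have Nmono s t : 0 <= s -> s <= t -> N t <= N s.
  move=> s0 st; have t0 := le_trans s0 st.
  have [b [Hb bs]] := curve_least_norm rA Au0 u_lip u_evi s0 st (aP _ s0).1.
  by apply: le_trans bs; exact: (aP _ t0).2 Hb.1.
exists [set t | 0 <= t /\
    exists2 e, 0 < e & forall s, 0 <= s -> s < t -> N t + e <= N s].
  exact: countable_left_jumps.
move=> t t0 nj; exists (a t); first exact/aP/ltW.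
apply: (curve_derivative mA rA Au0 u_lip u_evi t0 (aP _ (ltW t0))) => e e0.
(* If left continuity fails with gap [e], then [t] is one of the excluded jump times of [N]. *)
apply: contrapT => nex; apply: nj; split; first exact: ltW.
exists e => // s s0 st.
rewrite leNgt; apply/negP => Ns; apply: nex; exists s, (a s).
by split=> //; [exact: (aP _ s0).1|exact: ltW].
Qed.

End MonotoneFlowExistence.

(** * Subdifferentials and resolvents *)

Section Subdifferential.
Set Implicit Arguments.
Unset Strict Implicit.
Context {R : realType} {d : nat}.
Local Notation V := 'rV[R]_d.
Implicit Types (f h : V -> \bar R) (x y v w : V).

Lemma proper_finite f : proper_fun f -> exists x r, f x = r%:E.
Proof.
by move=> [fN [x]]; rewrite /edom/= => fx; exists x; move: fx (fN x);
  case: (f x) => [r _ _|//|//]; exists r.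
Qed.

Lemma subdiffP f x v : proper_fun f ->
  subdiff f x v <-> exists2 r, f x = r%:E &
    forall y s, f y = s%:E -> r + dotp v (y - x) <= s.
Proof.
move=> pf; split=> [fxv|[r fx fxv] y].
  have [x0 [r0 fx0]] := proper_finite pf.
  have : f x != +oo%E by apply/eqP => fx; have := fxv x0; rewrite fx fx0.
  have := pf.1 x; case fx : (f x) => [r||]// _ _; exists r => // y s fy.
  by have := fxv y; rewrite fx fy -EFinD lee_fin.
have := pf.1 y; case fy : (f y) => [s||]// _; last by rewrite leey.
by rewrite fx -EFinD lee_fin; exact: fxv.
Qed.

Lemma subdiff_monotone f x y v w : proper_fun f ->
  subdiff f x v -> subdiff f y w -> 0 <= dotp (v - w) (x - y).
Proof.
move=> pf /subdiffP-/(_ pf)[r fx H] /subdiffP-/(_ pf)[s fy K].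
have := H _ _ fy; have := K _ _ fx; rewrite !dotpE; lra.
Qed.

Lemma fenchel_ge h x r v : h x = r%:E -> ((dotp x v - r)%:E <= fenchel h v)%E.
Proof. by move=> hx; apply: ereal_sup_ubound; exists x => //; rewrite hx. Qed.

Lemma proper_fenchel h : proper_fun h -> edom (fenchel h) !=set0 ->
  proper_fun (fenchel h).
Proof.
move=> /proper_finite[x [r hx]] dh; split=> // v.
by have := fenchel_ge v hx; case: (fenchel h v).
Qed.

Lemma fenchel_eq h x w r : proper_fun h -> subdiff h x w -> h x = r%:E ->
  fenchel h w = (dotp x w - r)%:E.
Proof.
move=> ph /subdiffP-/(_ ph)[r' hx H] hxr; move: hx; rewrite hxr => -[rr'].
apply/eqP; rewrite eq_le fenchel_ge// andbT; apply: ub_ereal_sup => _ [y _ <-].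
have := ph.1 y; case hy : (h y) => [s||]// _; last by rewrite leNye.
have := H _ _ hy; rewrite -EFinB lee_fin -rr' !dotpE (dotpC w y) (dotpC w x); lra.
Qed.

Lemma subdiff_fenchel h x w : proper_fun h -> subdiff h x w ->
  subdiff (fenchel h) w x.
Proof.
move=> ph hxw; have /subdiffP-/(_ ph)[r hx _] := hxw => v.
rewrite (fenchel_eq ph hxw hx) -EFinD; apply: le_trans (fenchel_ge v hx).
by rewrite lee_fin dotpBr; lra.
Qed.

Lemma subdiff_edom_fenchel h x w : proper_fun h -> subdiff h x w ->
  edom (fenchel h) w.
Proof.
move=> ph hxw; have /subdiffP-/(_ ph)[r hx _] := hxw.
by rewrite /edom/= (fenchel_eq ph hxw hx) ltry.
Qed.

Lemma affine_minorant h a : proper_fun h -> edom (fenchel h) a ->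
  exists C : R, forall x r, h x = r%:E -> dotp a x - C <= r.
Proof.
move=> ph; have [x0 [r0 hx0]] := proper_finite ph.
have := fenchel_ge a hx0; rewrite /edom/=; case E : (fenchel h a) => [C||]// _ _.
exists C => x r hx; have := fenchel_ge a hx; rewrite E lee_fin dotpC; lra.
Qed.

(** The sublevel sets within [K] are nested, hence form a filter base, and compactness gives a
    cluster point [p]. Were [F p] above some [F y], lower semicontinuity would separate [p] from the
    sublevel set of [y]. *)
Lemma lsc_compact_min (X : topologicalType) (F : X -> \bar R) (K : set X) :
  (forall z, F z != -oo%E) -> lower_semicontinuous F -> compact K ->
  K !=set0 -> exists2 p, K p & forall q, K q -> (F p <= F q)%E.
Proof.
move=> FN lscF cK [x0 Kx0].
pose B q := [set z | K z /\ (F z <= F q)%E].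
have FB : ProperFilter (filter_from K B).
  apply: filter_from_proper; last by move=> y Ky; exists y; split.
  apply: filter_from_filter; first by exists x0.
  move=> y z Ky Kz; have [yz|/ltW zy] := leP (F y) (F z).
    by exists y => // x [Kx xy]; split; split=> //; exact: le_trans xy yz.
  by exists z => // x [Kx xz]; split; split=> //; exact: le_trans xz zy.
have BK : filter_from K B K by exists x0 => // x [].
have [p [Kp clp]] := cK _ FB BK.
exists p => // y Ky; rewrite leNgt; apply/negP.
have := FN y; case Fy : (F y) => [r||]// _ rFp; last by rewrite ltNge leey in rFp.
have [W pW rW] := lscF _ _ rFp.
have [x [[_ xy] Wx]] := clp _ _ (ex_intro2 _ _ y Ky (@subset_refl _ (B y))) pW.
by have := rW _ Wx; rewrite -Fy ltNge xy.
Qed.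

Lemma lscD_continuous f (g : V -> R) : (forall x, f x != -oo%E) ->
  lower_semicontinuous f -> continuous g ->
  lower_semicontinuous (fun x => f x + (g x)%:E)%E.
Proof.
move=> fN lscf cg x a afg.
have [e e0 aef] : exists2 e : R, 0 < e & ((a - g x + e)%:E < f x)%E.
  move: afg (fN x); case: (f x) => [r||]//.
    rewrite -EFinD lte_fin => arg _; exists ((r + g x - a) / 2); first lra.
    by rewrite lte_fin; lra.
  by move=> _ _; exists 1 => //; rewrite ltry.
have [W xW aW] := lscf _ _ aef.
exists (W `&` [set y | g x - e < g y]).
  apply: filterI => //; apply: (cvgr_gt _ (cg x)).
  by rewrite ltrBlDr ltrDl.
move=> y [Wy /= gy]; move: (aW _ Wy).
case: (f y) => [r||]//; last by rewrite addye ?ltry.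
by rewrite -EFinD !lte_fin; lra.
Qed.

(** A failing subgradient inequality at the limit leaves room for a level [c] below [h x']; lower
    semicontinuity keeps [h (x t)] above [c], while the inequality at [x t] eventually forces it
    below. *)
Lemma subdiff_closed h (T : Type) (G : set_system T) (x w : T -> V)
    (x' w' : V) : ProperFilter G -> proper_fun h -> lower_semicontinuous h ->
  x t @[t --> G] --> x' -> w t @[t --> G] --> w' ->
  (forall t, subdiff h (x t) (w t)) -> subdiff h x' w'.
Proof.
move=> GP ph lsch xx' ww' hxw y.
have := ph.1 y; case hy : (h y) => [s||]// _; last by rewrite leey.
rewrite -leeBrDr// -EFinB leNgt; apply/negP => slt.
have [c sc chx] : exists2 c, s - dotp w' (y - x') < c & (c%:E < h x')%E.
  move: slt (ph.1 x'); case: (h x') => [r||]//.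
    by rewrite lte_fin => sr _; exists ((s - dotp w' (y - x') + r) / 2);
      rewrite ?lte_fin; lra.
  by move=> _ _; exists (s - dotp w' (y - x') + 1); rewrite ?ltry//; lra.
have [W xW cW] := lsch _ _ chx.
have cvgs : s - dotp (w t) (y - x t) @[t --> G] --> s - dotp w' (y - x').
  apply: cvgB; first exact: cvg_cst.
  by apply: cvg_dotp => //; apply: cvgB => //; exact: cvg_cst.
have G1 : G [set t | s - dotp (w t) (y - x t) < c] by exact: (cvgr_lt _ cvgs).
have G2 : G [set t | W (x t)] by exact: xx'.
have [t [/= tc Wt]] := filter_ex (filterI G1 G2).
have /subdiffP-/(_ ph)[r hx H] := hxw t.
by have := cW _ Wt; rewrite hx lte_fin; have := H _ _ hy; lra.
Qed.

End Subdifferential.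

Section ConvexResolvent.
Set Implicit Arguments.
Unset Strict Implicit.
Context {R : realType} {d : nat}.
Local Notation V := 'rV[R]_d.
Variable h : V -> \bar R.
Hypotheses (hh : Gamma0 h).

Let ph : proper_fun h. Proof. by case: hh. Qed.
Let lsch : lower_semicontinuous h. Proof. by case: hh. Qed.

Lemma econvex_real x y r s (t : R) : 0 <= t <= 1 -> h x = r%:E -> h y = s%:E ->
  exists2 c, h (t *: x + (1 - t) *: y) = c%:E & c <= t * r + (1 - t) * s.
Proof.
move=> t01 hx hy; case: hh => _ /(_ x y t t01) + _.
rewrite hx hy -!EFinM -EFinD; have := ph.1 (t *: x + (1 - t) *: y).
by case: (h _) => [c||]// _; rewrite lee_fin => cle; exists c.
Qed.

Section Minimization.
Variables (N : 'M[R]_d) (W : V).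
Hypothesis (NT : N^T = N).

Let psi (x : V) : R := 2^-1 * dotp (x *m N) x - dotp W x.

Let cvg_psi : continuous psi.
Proof.
move=> x.
have xx : y @[y --> x] --> x by exact: cvg_id.
have h1 : dotp (y *m N) y @[y --> x] --> dotp (x *m N) x.
  apply: (@cvg_dotp _ _ _ (nbhs x) _ id) => //.
  exact: (@cvg_mulmxr _ _ _ N _ (nbhs x) id).
have h2 : dotp W y @[y --> x] --> dotp W x.
  by apply: (@cvg_dotp _ _ _ (nbhs x) (fun=> W) id) => //; exact: cvg_cst.
apply: (@cvgB _ _ _ _ _ (fun y => 2^-1 * dotp (y *m N) y)) h2.
by apply: (@cvgM _ _ _ _ (fun=> 2^-1)) => //; exact: cvg_cst.
Qed.

Let psi_segment (x y : V) (t : R) : psi (t *: y + (1 - t) *: x) =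
  psi x + t * dotp (x *m N - W) (y - x)
  + t ^+ 2 * (2^-1 * dotp ((y - x) *m N) (y - x)).
Proof.
have NC (u v : V) : dotp (u *m N) v = dotp (v *m N) u.
  by rewrite dotp_mulmx NT dotpC.
have -> : t *: y + (1 - t) *: x = x + t *: (y - x).
  by apply/rowP => i; rewrite !mxE; ring.
move: (y - x) => z.
rewrite /psi mulmxDl -scalemxAl !dotpE (NC z x); lra.
Qed.

Let minimizer_subdiff x : (forall y, (h x + (psi x)%:E <= h y + (psi y)%:E)%E) ->
  subdiff h x (W - x *m N).
Proof.
move=> minx; have [x0 [r0 hx0]] := proper_finite ph.
have [r hx] : exists r, h x = r%:E.
  have := minx x0; rewrite hx0 -EFinD; have := ph.1 x.
  by case: (h x) => [r||]// _ _; exists r.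
apply/subdiffP => //; exists r => // y s hy.
pose E := s - r + dotp (x *m N - W) (y - x).
pose Q := 2^-1 * dotp ((y - x) *m N) (y - x).
suff E0 : 0 <= E by move: E0; rewrite /E -(opprB (x *m N)) dotpNl; lra.
have EQ t : 0 < t -> t <= 1 -> 0 <= E + t * Q.
  move=> t0 t1.
  have [c hc cle] : exists2 c, h (t *: y + (1 - t) *: x) = c%:E &
      c <= t * s + (1 - t) * r.
    by apply: econvex_real => //; rewrite ltW.
  have := minx (t *: y + (1 - t) *: x).
  rewrite hc hx -!EFinD lee_fin psi_segment -/Q => H.
  rewrite -(pmulr_rge0 _ t0) /E; lra.
rewrite leNgt; apply/negP => En.
(* Small enough that [t * |Q|] is at most half of [- E], so the quadratic term cannot compensate the
   negative slope. *)
pose t := Num.min 1 (- E / (2 * (`|Q| + 1))).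
have Q1 : 0 < 2 * (`|Q| + 1) by rewrite mulr_gt0// ltr_wpDl.
have t0 : 0 < t by rewrite lt_min ltr01 divr_gt0// oppr_gt0.
have t1 : t <= 1 by rewrite ge_min lexx.
have : t * (2 * (`|Q| + 1)) <= - E.
  by rewrite -ler_pdivlMr// ge_min lexx orbT.
have tQ : t * Q <= t * `|Q| by rewrite ler_pM2l// ler_norm.
have tQ0 : 0 <= t * `|Q| by rewrite mulr_ge0// ltW.
by have := EQ t t0 t1; lra.
Qed.

(* Minty's surjectivity for the subdifferential of h, with a positive definite
   matrix in place of the identity. *)
Lemma minty (a : V) (e : R) : edom (fenchel h) a -> 0 < e ->
  (forall x : V, e * dotp x x <= dotp (x *m N) x) ->
  exists x, subdiff h x (W - x *m N).
Proof.
move=> da e0 Ne.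
have [C HC] := affine_minorant ph da.
have [x0 [r0 hx0]] := proper_finite ph.
pose Phi (x : V) := (h x + (psi x)%:E)%E.
pose m0 := r0 + psi x0.
have Phi0 : Phi x0 = m0%:E by rewrite /Phi hx0.
(* Beyond this radius, [e / 2] times the squared norm beats the linear term, the constant [C] of the
   affine minorant and the level [m0]. The leading 1 ensures that the norm exceeds 1 there, so that
   constants are dominated by linear terms. *)
pose rho := 1 + 2 * (enorm (a - W) + `|C| + `|m0|) / e.
pose K := [set x : V | enorm x <= rho].
have far x : rho < enorm x -> (m0%:E < Phi x)%E.
  move=> xrho; rewrite /Phi; have := ph.1 x.
  case hx : (h x) => [s||]// _; last by rewrite addye// ltry.
  rewrite -EFinD lte_fin; have H1 := HC _ _ hx; have H2 := Ne x.
  have := cauchy_schwarz_norm (a - W) x; rewrite ler_norml => /andP[H3 _].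
  move: H2 H3; rewrite -enorm_sqr dotpBl /psi.
  set p := enorm x in xrho *; set B := enorm (a - W) => H2 H3.
  have B0 : 0 <= B by exact: enorm_ge0.
  have H4 : 2 * (B + `|C| + `|m0|) < (p - 1) * e.
    by rewrite -ltr_pdivrMr// ltrBrDl.
  have p1 : 1 <= p.
    apply: le_trans (ltW xrho); rewrite lerDl divr_ge0 ?(ltW e0)//.
    by rewrite mulr_ge0// !addr_ge0.
  have p0 : 0 < p by lra.
  have {}H4 : p * (2 * (B + `|C| + `|m0|)) < p * ((p - 1) * e).
    by rewrite ltr_pM2l.
  have H5 : (`|C| + `|m0|) <= p * (`|C| + `|m0|).
    by rewrite ler_peMl// addr_ge0.
  have := ler_norm C; have := ler_norm m0.
  have : 0 < p * e by rewrite mulr_gt0.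
  lra.
have Kx0 : K x0 by rewrite /K/= leNgt; apply/negP => /far; rewrite Phi0 ltxx.
have PhiN x : Phi x != -oo%E by have := ph.1 x; rewrite /Phi; case: (h x).
have lscPhi : lower_semicontinuous Phi by apply: lscD_continuous => //; exact: ph.1.
have cK : compact K by exact: compact_enorm_ball.
have [x Kx minx] := lsc_compact_min PhiN lscPhi cK (ex_intro _ _ Kx0).
exists x; apply: minimizer_subdiff => y.
have [yK|/far yK] := leP (enorm y) rho; first exact: minx.
by apply: le_trans (ltW yK); rewrite -Phi0; exact: minx.
Qed.

End Minimization.
End ConvexResolvent.

(** * Directions along which a set extends around a relative interior point *)

Section RelativeInterior.
Set Implicit Arguments.
Unset Strict Implicit.
Context {R : realType} {d : nat}.
Local Notation V := 'rV[R]_d.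

Lemma affine_hull_line (C : set V) a v (t : R) : C a -> C (a + v) ->
  affine_hull C (a + t *: v).
Proof.
move=> Ca Cav A [affA CA].
have -> : a + t *: v = t *: (a + v) + (1 - t) *: a.
  by apply/rowP => i; rewrite !mxE; ring.
by apply: affA; exact: CA.
Qed.

Lemma relint_near_line (C : set V) a v : relint C a -> C (a + v) ->
  \forall t \near (0 : R), C (a + t *: v).
Proof.
move=> [Ca nearC] Cav.
have cvg_line : a + t *: v @[t --> (0 : R)] --> a.
  have h0 : a + t *: v @[t --> (0 : R)] --> a + 0 *: v.
    apply: cvgD; first exact: cvg_cst.
    by apply: (@cvgZ _ _ _ _ _ id (fun=> v)); [exact: cvg_id|exact: cvg_cst].
  by rewrite scale0r addr0 in h0.
have nearH : \forall t \near (0 : R), affine_hull C (a + t *: v) -> C (a + t *: v).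
  exact: cvg_line nearC.
by apply: filterS nearH => t; apply; exact: affine_hull_line.
Qed.

(** Take increments [row i E] within [C] of maximal rank: a [v - a] outside their span could be
    appended. Being relatively interior, [a] can also be moved a little along each row in both
    senses. *)
Lemma relint_frame (C : set V) a : relint C a ->
  exists m (E : 'M[R]_(m, d)) (e : R), [/\ 0 < e,
    forall i, C (a + e *: row i E) /\ C (a - e *: row i E) &
    forall v, C v -> (v - a <= E)%MS].
Proof.
move=> Ca.
pose P r := `[< exists m (E : 'M[R]_(m, d)),
  (forall i, C (a + row i E)) /\ \rank E = r >].
have exP : exists r, P r.
  by exists 0%N; apply/asboolP; exists 0%N, 0; split=> [[]//|]; rewrite mxrank0.
have ubP r : P r -> (r <= d)%N.
  by move=> /asboolP[m [E [_ <-]]]; exact: rank_leq_col.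
have [r /asboolP[m [E [CE rE]]] maxr] := ex_maxnP exP ubP.
have : \forall t \near (0 : R), forall i : 'I_m, C (a + t *: row i E).
  have nearE i : \forall t \near (0 : R), C (a + t *: row i E).
    exact: relint_near_line.
  exact: filter_forall nearE.
move=> /nbhs_ballP[e /= e0 He].
exists m, E, (e / 2); split; first by rewrite divr_gt0.
  move=> i; rewrite -scaleNr; split; apply: He; rewrite /ball/= sub0r.
    by rewrite normrN gtr0_norm ?divr_gt0//; lra.
  by rewrite opprK gtr0_norm ?divr_gt0//; lra.
move=> v Cv; apply: contraT => nvE.
suff : (\rank E < \rank (col_mx E (v - a)))%N.
  rewrite rE ltnNge maxr//; apply/asboolP; exists (m + 1)%N, (col_mx E (v - a)).
  split=> // i; case: (split_ordP i) => j ->.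
    by rewrite rowKu.
  by rewrite rowKd row_id addrC subrK.
have /andP[sE _] : (E <= col_mx E (v - a))%MS && (v - a <= col_mx E (v - a))%MS.
  by rewrite -col_mx_sub.
rewrite ltn_neqAle mxrankS// andbT; apply: contra nvE => /eqP rEE.
have := mxrank_leqif_sup sE; rewrite rEE => -[_].
by rewrite eqxx => /esym; rewrite col_mx_sub => /andP[].
Qed.

End RelativeInterior.

Section ConstrainedResolvent.
Set Implicit Arguments.
Unset Strict Implicit.
Context {R : realType} {d : nat}.
Local Notation V := 'rV[R]_d.

Section Resolvent.
Variables (h : V -> \bar R) (a : V) (B : 'M[R]_d) (k : R) (g : V).
Hypotheses (hh : Gamma0 h) (ria : relint (edom (fenchel h)) a) (k0 : 0 < k).

Let ph : proper_fun h. Proof. by case: hh. Qed.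
Let N (e : R) : 'M[R]_d := k *: (B *m B^T) + e%:M.
Let W : V := a + g *m B^T.

Let NE e (x : V) : x *m N e = k *: (x *m B *m B^T) + e *: x.
Proof. by rewrite /N mulmxDr -scalemxAr mulmxA mul_mx_scalar. Qed.

Let WNE e (x : V) :
  W - x *m N e = a + (g - k *: (x *m B)) *m B^T - e *: x.
Proof. by rewrite NE /W mulmxBl -scalemxAl opprD !addrA. Qed.

(** The affine minorants of [h] with slopes [a + e *: row i E] and [a - e *: row i E] bound the
    coordinate from both sides. *)
Let coord_bound m (E : 'M[R]_(m, d)) (e : R) :
  (forall i, edom (fenchel h) (a + e *: row i E) /\
             edom (fenchel h) (a - e *: row i E)) ->
  exists2 c : R, 0 <= c & forall i x r, h x = r%:E ->
    `|e * dotp (row i E) x| <= r - dotp a x + c.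
Proof.
move=> HE.
have /choice[c cP] : forall i, exists c : R, forall x r, h x = r%:E ->
    `|e * dotp (row i E) x| <= r - dotp a x + c.
  move=> i; have [c1 H1] := affine_minorant ph (HE i).1.
  have [c2 H2] := affine_minorant ph (HE i).2.
  exists (`|c1| + `|c2|) => x r hx; have := H1 _ _ hx; have := H2 _ _ hx.
  rewrite !dotpE ler_norml.
  have := ler_norm c1; have := ler_norm c2; have := normr_ge0 c1.
  have := normr_ge0 c2; lra.
exists (\sum_i `|c i|); first exact: sumr_ge0.
move=> i x r hx; apply: le_trans (cP i _ _ hx) _; rewrite lerD2l.
by apply: le_trans (ler_norm _) _; rewrite (bigD1 i)//= lerDl sumr_ge0.
Qed.

(** The equation places [x] in the span of the rows of [E] and [B^T]: [e *: x] is an element of the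
    range of [B^T] minus the displacement from [a] of a point of the conjugate's domain. So it
    suffices to bound [x *m B] and [x *m E^T], uniformly in [e]. *)
Let regularized_bound : exists C : R, forall (e : R) x, 0 < e -> e <= 1 ->
  subdiff h x (W - x *m N e) -> enorm x <= C.
Proof.
have [x0 [r0 hx0]] := proper_finite ph.
have [m [E [d0 [d0_gt0 HE spanE]]]] := relint_frame ria.
have [c c0 Hc] := coord_bound HE.
have [ca Hca] := affine_minorant ph ria.1.
have [C C0 HC] := enorm_row_space (col_mx E B^T).
pose G := enorm (g + k *: (x0 *m B)).
(* The subgradient inequality tested at [x0] gives [key]; the quarter of [dotp x0 x0] comes from
   completing the square in the regularizing term, with [e <= 1]. Then [P] bounds [enorm (x *m B)],
   [Q] bounds [h x - dotp a x], and [T] the coordinates along [E]. *)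
pose c1 := r0 - dotp a x0 - dotp g (x0 *m B) + dotp x0 x0 / 4.
pose P := 1 + (G + `|c1 + ca|) / k.
pose Q := c1 + G * P.
pose T := (`|Q| + c) / d0.
have G0 : 0 <= G by exact: enorm_ge0.
have T0 : 0 <= T by rewrite divr_ge0 ?(ltW d0_gt0)// addr_ge0.
exists (C * (m%:R * T + P)) => e x e0 e1 hxw.
have /subdiffP-/(_ ph)[r hx Hx] := hxw.
have xD : (x <= col_mx E B^T)%MS.
  have ew : e *: x = (g - k *: (x *m B)) *m B^T - (W - x *m N e - a).
    by rewrite WNE; apply/rowP => i; rewrite !mxE; ring.
  have -> : x = e^-1 *: (e *: x) by rewrite scalerA mulVf ?gt_eqF// scale1r.
  have /andP[sE sB] : (E <= col_mx E B^T)%MS && (B^T <= col_mx E B^T)%MS.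
    by rewrite -col_mx_sub.
  rewrite ew scalemx_sub// addmx_sub ?eqmx_opp//.
    exact: submx_trans (submxMl _ _) sB.
  by apply: submx_trans sE; apply: spanE; exact: subdiff_edom_fenchel hxw.
apply: le_trans (HC _ xD) _; rewrite ler_wpM2l// tr_col_mx trmxK mul_mx_row.
set p := enorm (x *m B).
have p0 : 0 <= p by exact: enorm_ge0.
have key : r - dotp a x + k * p ^+ 2 - G * p <= c1.
  have := Hx _ _ hx0; rewrite WNE.
  have := cauchy_schwarz (g + k *: (x0 *m B)) (x *m B); rewrite -/G -/p.
  have quarter : 0 <= e * dotp (x0 - 2 *: x) (x0 - 2 *: x).
    by rewrite mulr_ge0 ?dotp_ge0// ltW.
  have x0e : 0 <= (1 - e) * dotp x0 x0 by rewrite mulr_ge0 ?dotp_ge0// subr_ge0.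
  have trB (u v : V) : dotp (u *m B^T) v = dotp u (v *m B).
    by rewrite dotp_mulmx trmxK.
  move: quarter x0e; rewrite /c1 /p enorm_sqr.
  rewrite mulmxBl -scalemxAl !dotpE !trB (dotpC x x0) (dotpC (x0 *m B)).
  lra.
have Hlow := Hca _ _ hx.
have pP : p <= P.
  have [p1|/ltW p1] := leP p 1.
    by apply: le_trans p1 _; rewrite lerDl divr_ge0 ?(ltW k0)// addr_ge0.
  have pp : 0 < p by lra.
  suff : p <= (G + `|c1 + ca|) / k by rewrite /P; lra.
  rewrite ler_pdivlMr// -(ler_pM2l pp).
  have h1 : `|c1 + ca| <= p * `|c1 + ca| by rewrite ler_peMl.
  have h2 := ler_norm (c1 + ca).
  by rewrite mulrDr; lra.
have GpP : G * p <= G * P by rewrite ler_wpM2l.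
have kp : 0 <= k * p ^+ 2 by rewrite mulr_ge0 ?sqr_ge0// ltW.
have HQ : r - dotp a x <= Q by rewrite /Q; lra.
apply: le_trans (enorm_row_mx _ _) _; apply: lerD => //.
apply: enorm_le_coord => // i.
have -> : (x *m E^T) ord0 i = dotp (row i E) x.
  by rewrite mxE; apply: eq_bigr => j _; rewrite !mxE mulrC.
have := Hc i _ _ hx; rewrite normrM gtr0_norm// /T ler_pdivlMr// mulrC.
by move=> /le_trans; apply; rewrite lerD2r; apply: le_trans HQ (ler_norm _).
Qed.

(* The minimization problem behind the resolvent is not coercive; it is solved
   with a vanishing quadratic regularization. *)
Lemma constrained_resolvent :
  exists x, subdiff h x (a + (g - k *: (x *m B)) *m B^T).
Proof.
have [C HC] := regularized_bound.
have /choice[x xP] : forall n : nat, exists x,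
    subdiff h x (W - x *m N n.+1%:R^-1).
  move=> n; apply: (minty hh _ _ ria.1 (e := n.+1%:R^-1)) => //.
    by rewrite /N linearD/= linearZ/= trmx_mul trmxK tr_scalar_mx.
  move=> y; rewrite NE !dotpE dotp_mulmx trmxK lerDr.
  by rewrite mulr_ge0 ?dotp_ge0// ltW.
have [G [GU ooG]] := ultraFilterLemma (@eventually_filter).
have [x' xx'] : exists x' : V, x n @[n --> G] --> x'.
  apply: (ultra_bounded_cvg GU (C := C)); apply: filterE => n.
  by apply: HC (xP n) => //; rewrite invf_le1// ler1n.
have harm : n.+1%:R^-1 @[n --> G] --> (0 : R).
  by apply: cvg_trans (@cvg_harmonic R) => A; exact: ooG.
exists x'; case: hh => _ _ lsch.
apply: (subdiff_closed _ ph lsch xx' _ xP).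
have -> : a + (g - k *: (x' *m B)) *m B^T
    = a + (g - k *: (x' *m B)) *m B^T - 0 *: x' by rewrite scale0r subr0.
under eq_cvg do rewrite WNE.
apply: cvgB; last exact: cvgZ.
apply: cvgD; first exact: cvg_cst.
apply: cvg_mulmxr; apply: cvgB; first exact: cvg_cst.
apply: (@cvgZ _ _ _ _ _ (fun=> k)); first exact: cvg_cst.
exact: cvg_mulmxr.
Qed.

End Resolvent.
End ConstrainedResolvent.

(** * Linear algebra and almost everywhere derivatives *)

Section PsdFactorization.
Set Implicit Arguments.
Unset Strict Implicit.
Context {R : realType}.

(** Cholesky factorization by Schur complements. A zero pivot forces its row to vanish. *)
Lemma psd_factorization n (M : 'M[R]_n) : M^T = M ->
  (forall x : 'rV[R]_n, 0 <= dotp x (x *m M)) -> exists B : 'M[R]_n, M = B *m B^T.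
Proof.
elim: n M => [M _ _|n IH]; first by exists 0; apply/matrixP => -[].
suff step (M : 'M[R]_(1 + n)) : M^T = M ->
    (forall x : 'rV[R]_(1 + n), 0 <= dotp x (x *m M)) ->
    exists B : 'M[R]_(1 + n), M = B *m B^T by exact: step.
move=> MT Mpsd.
pose D := drsubmx M; pose b : 'rV[R]_n := ursubmx M; pose al := M ord0 ord0.
have ME : M = block_mx al%:M b b^T D.
  rewrite -{1}(submxK M) -/D -/b; congr block_mx.
    rewrite [ulsubmx M]mx11_scalar; congr _%:M; rewrite !mxE /al; congr (M _ _);
    exact: val_inj.
  by rewrite /b trmx_ursub MT.
have DT : D^T = D by rewrite /D trmx_drsub MT.
have quad (s : R) (y : 'rV[R]_n) :
    0 <= s ^+ 2 * al + 2 * s * dotp b y + dotp y (y *m D).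
  have := Mpsd (row_mx s%:M y); rewrite ME mul_row_block dotp_row_mx !dotpDr.
  have sE (v : 'rV[R]_1) : dotp s%:M v = s * v ord0 ord0.
    by rewrite /dotp big_ord1 mxE eqxx mulr1n.
  rewrite !sE !mul_scalar_mx !mxE eqxx mulr1n.
  have -> : \sum_j y ord0 j * b^T j ord0 = dotp b y.
    by apply: eq_bigr => j _; rewrite !mxE mulrC.
  rewrite dotpZr (dotpC y b) expr2; lra.
have al0 : 0 <= al.
  have := quad 1 0; rewrite dotp0r mul0mx dotp0r; lra.
have [al00|aln0] := eqVneq al 0.
  have b0 : b = 0.
    apply/dotp_eq0/eqP; rewrite eq_le dotp_ge0 andbT leNgt; apply/negP => bb.
    (* This scalar makes the quadratic form equal to -1. *)
    have := quad (- (dotp b (b *m D) + 1) / (2 * dotp b b)) b.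
    rewrite al00 mulr0 add0r.
    have -> : 2 * (- (dotp b (b *m D) + 1) / (2 * dotp b b)) * dotp b b
      = - (dotp b (b *m D) + 1) by field; rewrite gt_eqF.
    lra.
  have [B DE] : exists B : 'M[R]_n, D = B *m B^T.
    apply: IH => // y; have := quad 0 y; rewrite expr0n/= mulr0 !mul0r !add0r.
    exact.
  exists (block_mx 0 0 0 B).
  rewrite tr_block_mx mulmx_block !trmx0 !(mul0mx, mulmx0, addr0, add0r) -DE.
  by rewrite ME al00 b0 trmx0 raddf0.
have al_gt0 : 0 < al by rewrite lt_def aln0.
pose ga := Num.sqrt al.
have ga2 : ga * ga = al by rewrite -expr2 sqr_sqrtr.
have gan0 : ga != 0 by rewrite gt_eqF// sqrtr_gt0.
have [B DE] : exists B : 'M[R]_n, D - al^-1 *: (b^T *m b) = B *m B^T.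
  apply: IH => [|y].
    by rewrite linearB/= linearZ/= trmx_mul trmxK DT.
  (* The minimizing scalar: the form reduces to that of the Schur complement. *)
  have := quad (- (dotp b y / al)) y.
  have bb : y *m (b^T *m b) = dotp b y *: b.
    rewrite mulmxA [y *m b^T]mx11_scalar mul_scalar_mx; congr (_ *: _).
    by rewrite -dotp_mxE dotpC.
  rewrite mulmxBr -scalemxAr bb !dotpE (dotpC y b).
  congr (_ <= _); field; exact: aln0.
exists (block_mx ga%:M 0 (ga^-1 *: b^T) B).
rewrite tr_block_mx mulmx_block !trmx0 !(mul0mx, mulmx0, addr0, add0r) -DE.
rewrite tr_scalar_mx linearZ/= trmxK !mul_scalar_mx mul_mx_scalar.
rewrite scale_scalar_mx ga2 !scalerA mulfV// !scale1r -scalemxAl -scalemxAr.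
rewrite scalerA -invfM ga2 [X in block_mx _ _ _ X]addrC subrK.
exact: ME.
Qed.

End PsdFactorization.

(** * Monotonicity from the sign of an almost everywhere derivative *)

Section AlmostEverywhereMonotone.
Set Implicit Arguments.
Unset Strict Implicit.
Context {R : realType}.
Local Notation mu := (@lebesgue_measure R).

(** Consider the supremum of the times where [F] is at most [F 0]. The bound on upward growth shows
    that it is attained, and the local condition moves past it unless it is [T]. *)
Lemma right_nonincreasing (F : R -> R) (T K : R) : 0 <= T ->
  (forall s t, 0 <= s -> s <= t -> t <= T -> F t <= F s + K * (t - s)) ->
  (forall t, 0 <= t -> t < T -> exists2 e, 0 < e &
    forall r, t <= r -> r < t + e -> r <= T -> F r <= F t) ->
  F T <= F 0.
Proof.
move=> T0 upper_lip right_le.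
pose S := [set t | [/\ 0 <= t, t <= T & F t <= F 0]].
have S0 : S 0 by split.
have ubS : ubound S T by move=> t [].
have supS : has_sup S by split; [exists 0|exists T].
set s := sup S.
have s0 : 0 <= s by apply: ub_le_sup => //; exists T.
have sT : s <= T by apply: ge_sup => //; exists 0.
have Fs : F s <= F 0.
  apply/ler_addgt0Pr => e e0.
  have K1 : 0 < `|K| + 1 by rewrite ltr_wpDl.
  have [t [t0 tT Ft] st] := sup_adherent (divr_gt0 e0 K1) supS.
  have ts : t <= s by apply: ub_le_sup; [exists T|split].
  have := upper_lip _ _ t0 ts sT.
  have : K * (s - t) <= e.
    have h1 : K * (s - t) <= (`|K| + 1) * (s - t).
      rewrite ler_wpM2r ?subr_ge0//; have := ler_norm K; lra.
    apply: le_trans h1 _; rewrite mulrC -ler_pdivlMr//.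
    by move: st; rewrite -/s; lra.
  lra.
have [sltT|Ts] := ltP s T; last first.
  by rewrite (_ : T = s)//; apply/eqP; rewrite eq_le Ts sT.
have [e e0 He] := right_le _ s0 sltT.
pose r := Num.min T (s + e / 2).
have sr : s < r by rewrite lt_min sltT ltrDl divr_gt0.
have rT : r <= T by rewrite ge_min lexx.
have re : r < s + e by rewrite gt_min; apply/orP; right; lra.
have Sr : S r.
  split=> //; first exact: le_trans s0 (ltW sr).
  by apply: le_trans Fs; apply: He => //; exact: ltW.
have : r <= s by apply: ub_le_sup => //; exists T.
by rewrite leNgt sr.
Qed.

(* The jump of f across the null set of bad times is absorbed by the measure
   of an open neighbourhood of that set. *)
Lemma ae_nonincreasing (f : R -> R) (T K : R) : 0 <= T -> 0 <= K ->
  (forall s t, 0 <= s -> s <= t -> t <= T -> `|f t - f s| <= K * (t - s)) ->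
  (\forall t \ae mu, 0 <= t -> exists2 l : R, l <= 0 &
     h^-1 * (f (h + t) - f t) @[h --> (0 : R)^'] --> l) ->
  f T <= f 0.
Proof.
move=> T0 K0 f_lip [A [mA A0 badA]].
apply/ler_addgt0Pr => e e0.
(* Both [eta * T] and [K * eps] are at most [e / 2]; adding 1 keeps the denominators positive. *)
pose eta := e / (2 * (T + 1)); pose eps := e / (2 * (K + 1)).
have eta0 : 0 < eta by rewrite divr_gt0// mulr_gt0// ltr_wpDl.
have eps0 : 0 < eps by rewrite divr_gt0// mulr_gt0// ltr_wpDl.
have [|U [oU AU mUA]] := lebesgue_regularity_outer mA _ eps0.
  by rewrite [ltLHS]A0 ltry.
have mU : measurable U by exact: measurable_realfun.open_measurable.
have mUe : (mu U < eps%:E)%E.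
  have -> : U = (U `\` A) `|` A by rewrite setUC setDUK.
  rewrite measureU//; last 2 first.
    exact: measurableD.
    by rewrite setDE -setIA setICl setI0.
  by rewrite [X in (_ + X)%E]A0 adde0.
have mu_le (X Y : set R) : measurable X -> measurable Y -> X `<=` Y ->
    (mu X <= mu Y)%E.
  by move=> mX mY XY; apply: le_measure => //; exact: mem_set.
pose I t := U `&` `[0, t]%classic.
have mI t : measurable (I t) by apply: measurableI => //; exact: measurable_itv.
have I_le t : (mu (I t) <= mu U)%E.
  by apply: mu_le => // x [].
have I_fin t : mu (I t) \is a fin_num.
  by rewrite ge0_fin_numE//; apply: le_lt_trans (I_le t) (lt_trans mUe (ltry _)).
pose m t := fine (mu (I t)).
have m_mono s t : s <= t -> m s <= m t.
  move=> st; apply: fine_le => //; apply: mu_le => //.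
  by move=> x [Ux]; rewrite /= !in_itv/= => /andP[x0 xs]; split=> //;
    rewrite /= in_itv/= x0 (le_trans xs).
have m_ge0 t : 0 <= m t by exact: fine_ge0.
have m_le t : m t <= eps.
  by rewrite -lee_fin fineK//; apply: le_trans (I_le t) (ltW mUe).
have m_slope s t : 0 <= s -> s <= t -> `]s, t]%classic `<=` U ->
    m s + (t - s) <= m t.
  move=> s0 st sub.
  have lenE : mu `]s, t]%classic = (t - s)%:E.
    rewrite lebesgue_measure_itv/= lte_fin; case: ltP => [//|ts].
    by rewrite (_ : t = s) ?subrr//; apply/eqP; rewrite eq_le ts st.
  rewrite -lee_fin EFinD !fineK// -lenE -measureU//; last 2 first.
  - exact: mI.
  - apply/seteqP; split=> // x [[_]]; rewrite /= !in_itv/= => /andP[_ xs].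
    by move=> /andP[sx _]; have := lt_le_trans sx xs; rewrite ltxx.
  apply: mu_le => //; first by apply: measurableU => //; exact: measurable_itv.
  move=> x [[Ux]|xst]; rewrite /I/= in_itv/=.
    by move=> /andP[x0 xs]; split=> //; rewrite in_itv/= x0 (le_trans xs).
  split; first exact: sub.
  move: xst; rewrite /= !in_itv/= => /andP[sx ->]; rewrite andbT.
  exact: le_trans s0 (ltW sx).
(* Inside [U], [m] has slope one, so [K * m] absorbs the Lipschitz growth of [f]; outside [U], the
   derivative of [f] is at most 0 and [eta] leaves strict room. *)
pose F t := f t - eta * t - K * m t.
have : F T <= F 0.
  apply: (@right_nonincreasing F T K) => // [s t s0 st tT|t t0 tT].
    have := f_lip _ _ s0 st tT; rewrite ler_norml => /andP[_ H].
    have h1 : K * m s <= K * m t by rewrite ler_wpM2l// m_mono.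
    have h2 : eta * s <= eta * t by rewrite ler_pM2l.
    rewrite /F; lra.
  have [Ut|nUt] := pselect (U t).
    have /nbhs_ballP[r /= r0 rU] : nbhs t U by exact: open_nbhs_nbhs.
    exists r => // v tv vr vT.
    have := f_lip _ _ t0 tv vT; rewrite ler_norml => /andP[_ H].
    have h1 : m t + (v - t) <= m v.
      apply: m_slope => // x; rewrite /= in_itv/= => /andP[tx xv]; apply: rU.
      rewrite /ball/= ltr_distl; lra.
    have h2 : eta * t <= eta * v by rewrite ler_pM2l.
    have h3 : K * (m t + (v - t)) <= K * m v by rewrite ler_wpM2l.
    rewrite /F; lra.
  have [l l0 lim_l] : exists2 l : R, l <= 0 &
      h^-1 * (f (h + t) - f t) @[h --> (0 : R)^'] --> l.
    by apply: contrapT => nl; apply/nUt/AU/badA => /= H; exact/nl/H.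
  have /nbhs_ballP[r /= r0 Hr] : \forall h \near (0 : R)^',
      h^-1 * (f (h + t) - f t) <= eta.
    by apply: (cvgr_le _ lim_l); exact: le_lt_trans l0 eta0.
  exists r => // v tv vr vT.
  have [->//|vt] := eqVneq v t.
  have hp : 0 < v - t by rewrite subr_gt0 lt_def vt.
  have : (v - t)^-1 * (f (v - t + t) - f t) <= eta.
    apply: Hr; last by rewrite gt_eqF.
    by rewrite /ball/= sub0r normrN gtr0_norm//; lra.
  rewrite subrK ler_pdivrMl// => H.
  have h1 : K * m t <= K * m v by rewrite ler_wpM2l// m_mono.
  rewrite /F; lra.
rewrite /F mulr0 subr0 => H.
have h1 : eta * T <= e / 2.
  rewrite /eta mulrAC ler_pdivrMr ?mulr_gt0 ?ltr_wpDl//.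
  have := e0; lra.
have h2 : K * m T <= e / 2.
  apply: (@le_trans _ _ (K * eps)); first by rewrite ler_wpM2l.
  rewrite /eps mulrCA ler_pM2l// ler_pdivrMr ?mulr_gt0 ?ltr_wpDl//; lra.
have h3 : 0 <= K * m 0 by rewrite mulr_ge0.
lra.
Qed.

End AlmostEverywhereMonotone.

Section MirrorFlow.
Set Implicit Arguments.
Unset Strict Implicit.
Context {R : realType}.
Local Notation mu := (@lebesgue_measure R).

Lemma quotient_derive1 (W : normedModType R) (w : R -> W) (t : R) (l : W) :
  h^-1 *: (w (h + t) - w t) @[h --> (0 : R)^'] --> l ->
  derivable w t 1 /\ derive1 w t = l.
Proof.
move=> wl; split; last by apply: cvg_lim => //; exact: norm_hausdorff.
rewrite /derivable; apply/cvg_ex; exists l => /=.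
by under eq_fun do rewrite /GRing.scale/= mulr1.
Qed.

Lemma derive1_quotient (W : normedModType R) (w : R -> W) (t : R) :
  derivable w t 1 ->
  h^-1 *: (w (h + t) - w t) @[h --> (0 : R)^'] --> derive1 w t.
Proof.
by rewrite derive1E => dw; have := dw; rewrite /derivable/= /derive => /cvgP;
  under eq_fun do rewrite /GRing.scale/= mulr1.
Qed.

Lemma lipschitz_half_line (W : normedModType R) (w : R -> W) :
  [lipschitz w t | t in [set t : R | 0 <= t]] <->
  exists2 K : R, 0 <= K & forall s t, 0 <= s -> s <= t ->
    `|w t - w s| <= K * (t - s).
Proof.
split=> [lw|[K K0 wK]].
  have [K [Kpos HK]] := pinfty_ex_gt0 lw.
  exists K; first exact: ltW.
  move=> s t s0 st; have := HK (t, s) (conj (le_trans s0 st) s0).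
  by rewrite /= [X in _ * X]ger0_norm// subr_ge0.
have PF : ProperFilter (globally ([set t : R | 0 <= t] `*` [set t : R | 0 <= t])).
  by apply: (@globally_properfilter _ _ (0, 0)); split=> /=.
apply: (@klipschitzW _ _ _ K) => -[t s] [/= t0 s0].
have [st|/ltW ts] := leP s t.
  by rewrite [X in _ * X]ger0_norm ?subr_ge0//; exact: wK.
by rewrite distrC (distrC t) [X in _ * X]ger0_norm ?subr_ge0//; exact: wK.
Qed.

Context {d : nat}.
Local Notation V := 'rV[R]_d.
Variables (M : 'M[R]_d) (q : V) (c : R).
Hypothesis (MT : M^T = M).

Lemma quad_loss_line (x v : V) (t : R) :
  quad_loss M q c (x + t *: v) = quad_loss M q c x + t * dotp (x *m M - q) v
  + t ^+ 2 * (2^-1 * dotp v (v *m M)).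
Proof.
have MC (y z : V) : dotp y (z *m M) = dotp z (y *m M).
  by rewrite dotpC dotp_mulmx MT.
rewrite /quad_loss /mxapp MT mulmxDl -scalemxAl !dotpE (MC v x).
rewrite (dotpC (x *m M) v) (MC v x); lra.
Qed.

Lemma gradient_quad_loss x : gradient (quad_loss M q c) x = x *m M - q.
Proof.
apply/rowP => i; rewrite mxE; set v := delta_mx ord0 i.
have -> : (x *m M - q) ord0 i = dotp (x *m M - q) v.
  rewrite /dotp (bigD1 i)//= big1 ?addr0.
    by rewrite [v _ _]mxE !eqxx mulr1.
  by move=> j ji; rewrite [v _ _]mxE eqxx (negPf ji) mulr0.
apply: cvg_lim => //=.
have lim_h : dotp (x *m M - q) v + h * (2^-1 * dotp v (v *m M)) @[h --> (0 : R)^']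
    --> dotp (x *m M - q) v + 0 * (2^-1 * dotp v (v *m M)).
  apply: cvgD; first exact: cvg_cst.
  apply: (@cvgM _ _ _ _ id); last exact: cvg_cst.
  exact: cvg_within.
rewrite mul0r addr0 in lim_h; apply: cvg_trans lim_h.
apply: near_eq_cvg; near=> h.
have h0 : h != 0 by near: h; exact: nbhs_dnbhs_neq.
rewrite /= (addrC (h *: v)) quad_loss_line /GRing.scale/=.
by field.
Unshelve. all: by end_near. Qed.

End MirrorFlow.

(** * Mirror flow *)

Section LebesgueAlmostEverywhere.
Context {R : realType}.
Local Notation mu := (@lebesgue_measure R).

Lemma lebesgue_ae_filter : Filter (almost_everywhere mu).
Proof. exact: ae_filter_ringOfSetsType. Qed.

Lemma lebesgue_aeS (P Q : R -> Prop) : (forall t, P t -> Q t) ->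
  (\forall t \ae mu, P t) -> \forall t \ae mu, Q t.
Proof. exact: (@filterS _ _ lebesgue_ae_filter P Q). Qed.

Lemma lebesgue_aeS2 (P Q S : R -> Prop) : (forall t, P t -> Q t -> S t) ->
  (\forall t \ae mu, P t) -> (\forall t \ae mu, Q t) -> \forall t \ae mu, S t.
Proof. exact: (@filterS2 _ _ lebesgue_ae_filter P Q S). Qed.

End LebesgueAlmostEverywhere.

(** * Uniqueness of the flow *)

Section Uniqueness.
Set Implicit Arguments.
Unset Strict Implicit.
Context {R : realType} {d : nat}.
Local Notation V := 'rV[R]_d.
Local Notation mu := (@lebesgue_measure R).
Variables (M B P : 'M[R]_d) (q : V) (c : R) (h : V -> \bar R) (w0 : V).
Hypotheses (MB : M = B *m B^T) (MPM : M *m P *m M = M) (ph : proper_fun h).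

Let MT : M^T = M. Proof. by rewrite MB trmx_mul trmxK. Qed.

(** A symmetric positive semidefinite generalized inverse of [M], built from any generalized inverse
    [P]. *)
Let G : 'M[R]_d := P *m M *m P^T.

Let GT : G^T = G. Proof. by rewrite /G !trmx_mul trmxK MT mulmxA. Qed.

Let MGM : M *m G *m M = M.
Proof.
rewrite /G !mulmxA MPM.
by rewrite -[in RHS]MT -[in RHS]MPM !trmx_mul MT mulmxA.
Qed.

(* The squared distance of two solutions, measured with G, does not increase;
   their difference stays in the span of M, where G is definite. *)
Lemma mirror_flow_unique w1 w2 :
  lipschitz_mirror_flow_from h (quad_loss M q c) w0 w1 ->
  lipschitz_mirror_flow_from h (quad_loss M q c) w0 w2 ->
  forall t, 0 <= t -> w1 t = w2 t.
Proof.
move=> [/lipschitz_half_line[K1 K10 lip1] [x1 px1] w10].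
move=> [/lipschitz_half_line[K2 K20 lip2] [x2 px2] w20].
pose z t : V := w1 t - w2 t.
pose K := d%:R * (K1 + K2).
have K0 : 0 <= K by rewrite mulr_ge0// addr_ge0.
have z0 : z 0 = 0 by rewrite /z w10 w20 subrr.
have lipz s t : 0 <= s -> s <= t -> enorm (z t - z s) <= K * (t - s).
  move=> s0 st; apply: le_trans (enorm_le_norm _) _; rewrite -mulrA ler_wpM2l//.
  have -> : z t - z s = (w1 t - w1 s) - (w2 t - w2 s).
    by apply/rowP => i; rewrite !mxE; ring.
  by rewrite mulrDl; apply: le_trans (ler_normB _ _) _; rewrite lerD// (lip1, lip2).
have dz : \forall t \ae mu, 0 <= t -> exists2 y : V, dotp y (z t) <= 0 &
    r^-1 *: (z (r + t) - z t) @[r --> (0 : R)^'] --> y *m M.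
  move: px1 px2; rewrite /primal_variable; apply: lebesgue_aeS2 => t p1 p2 t0.
  have [D1 E1 S1] := p1 t0; have [D2 E2 S2] := p2 t0.
  exists (x2 t - x1 t).
    rewrite -(opprB (x1 t)) dotpNl oppr_le0 dotpC.
    exact: subdiff_monotone ph S1 S2.
  have -> : (x2 t - x1 t) *m M = derive1 w1 t - derive1 w2 t.
    rewrite E1 E2 !gradient_quad_loss// mulmxBl; apply/rowP => i.
    by rewrite !mxE; ring.
  rewrite (_ : (fun r => _) = fun r => r^-1 *: (w1 (r + t) - w1 t)
      - r^-1 *: (w2 (r + t) - w2 t)).
    by apply: cvgB; exact: derive1_quotient.
  by apply/funext => r; apply/rowP => i; rewrite !mxE; ring.
suff zT0 T : 0 <= T -> z T = 0.
  by move=> T T0; apply: subr0_eq; exact: zT0.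
clearbody z.
have zspan t : 0 <= t -> z t = z t *m G *m M.
  move=> t0; pose N := 1%:M - G *m M.
  have MN : M *m N = 0 by rewrite mulmxBr mulmx1 mulmxA MGM subrr.
  suff : z t *m N = 0 by rewrite mulmxBr mulmx1 mulmxA => /subr0_eq.
  apply: dotp_eq0; apply/eqP; rewrite eq_le dotp_ge0 andbT.
  (* The test vector is frozen at its value at time [t]: the resulting scalar function of [s] has
     zero derivative almost everywhere because [M *m N = 0]. *)
  set v := (X in dotp _ X); clearbody v.
  have [C C0 HC] := enorm_mulmx_bound N.
  rewrite [leRHS](_ : 0 = dotp (z 0 *m N) v); last by rewrite z0 mul0mx dotp0l.
  apply: (@ae_nonincreasing _ (fun s => dotp (z s *m N) v) t
    (C * enorm v * K)) => //.
  - by rewrite mulr_ge0// mulr_ge0 ?enorm_ge0.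
  - move=> r s r0 rs _; rewrite -dotpBl -mulmxBl.
    apply: le_trans (cauchy_schwarz_norm _ _) _.
    rewrite (_ : C * enorm v * K * (s - r) = C * (K * (s - r)) * enorm v);
      last by ring.
    rewrite ler_wpM2r ?enorm_ge0//.
    by apply: le_trans (HC _) _; rewrite ler_wpM2l// lipz.
  - move: (dz); apply: lebesgue_aeS => s dzs /dzs[y _ dy]; exists 0 => //.
    rewrite [X in _ --> X](_ : 0 = dotp (y *m M *m N) v); last first.
      by rewrite -mulmxA MN mulmx0 dotp0l.
    have -> : (fun r => r^-1 * (dotp (z (r + s) *m N) v - dotp (z s *m N) v))
        = fun r => dotp ((r^-1 *: (z (r + s) - z s)) *m N) v.
      by apply/funext => r; rewrite -scalemxAl dotpZl mulmxBl dotpBl.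
    by apply: cvg_dotp; [exact: cvg_mulmxr|exact: cvg_cst].
move=> T0.
have normz s : 0 <= s -> enorm (z s) <= K * s.
  by move=> s0; have := lipz _ _ (lexx 0) s0; rewrite z0 !subr0.
have [C C0 HC] := enorm_mulmx_bound G.
have zG0 : dotp (z T *m G) (z T) <= 0.
  rewrite [leRHS](_ : 0 = dotp (z 0 *m G) (z 0)); last by rewrite z0 dotp0r.
  apply: (@ae_nonincreasing _ (fun s => dotp (z s *m G) (z s)) T
    (2 * (C * K * (K * T)))) => //.
  - by apply: mulr_ge0 => //; apply: mulr_ge0; exact: mulr_ge0.
  - move=> r s r0 rs sT.
    have -> : dotp (z s *m G) (z s) - dotp (z r *m G) (z r) =
        dotp ((z s - z r) *m G) (z s) + dotp (z r *m G) (z s - z r).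
      by rewrite mulmxBl !dotpE; ring.
    have KT t : 0 <= t -> t <= T -> enorm (z t) <= K * T.
      by move=> t0 tT; apply: le_trans (normz _ t0) _; rewrite ler_wpM2l.
    have s0 := le_trans r0 rs; have rT := le_trans rs sT.
    have h1 : `|dotp ((z s - z r) *m G) (z s)| <= C * K * (K * T) * (s - r).
      apply: le_trans (cauchy_schwarz_norm _ _) _.
      rewrite (_ : C * K * (K * T) * (s - r) = C * (K * (s - r)) * (K * T));
        last by ring.
      apply: ler_pM; rewrite ?enorm_ge0//; last exact: KT.
      by apply: le_trans (HC _) _; rewrite ler_wpM2l// lipz.
    have h2 : `|dotp (z r *m G) (z s - z r)| <= C * K * (K * T) * (s - r).
      apply: le_trans (cauchy_schwarz_norm _ _) _.
      rewrite (_ : C * K * (K * T) * (s - r) = C * (K * T) * (K * (s - r)));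
        last by ring.
      apply: ler_pM; rewrite ?enorm_ge0//; last exact: lipz.
      by apply: le_trans (HC _) _; rewrite ler_wpM2l// KT.
    by apply: le_trans (ler_normD _ _) _; lra.
  - move: (dz); apply: lebesgue_aeS => s dzs s0; have [y yz dy] := dzs s0.
    exists (dotp (y *m M *m G) (z s) + dotp (z s *m G) (y *m M)).
      have -> : dotp (z s *m G) (y *m M) = dotp (y *m M *m G) (z s).
        by rewrite dotp_mulmx GT dotpC.
      (* Here the span condition is needed: [G] cancels [M] only against vectors of the form
         [z s *m G *m M]. The derivative is then twice [dotp y (z s)]. *)
      have -> : dotp (y *m M *m G) (z s) = dotp y (z s).
        have shiftM (a b : V) : dotp a (b *m M) = dotp (a *m M) b.
          by rewrite [RHS]dotp_mulmx MT.
        rewrite [in LHS](zspan _ s0) shiftM -!(mulmxA y) MGM -shiftM.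
        by rewrite -zspan.
      lra.
    have -> : (fun r => r^-1 * (dotp (z (r + s) *m G) (z (r + s))
          - dotp (z s *m G) (z s)))
        = fun r => dotp ((r^-1 *: (z (r + s) - z s)) *m G)
            (z s + r *: (r^-1 *: (z (r + s) - z s)))
          + dotp (z s *m G) (r^-1 *: (z (r + s) - z s)).
      apply/funext => r; have [->|r0] := eqVneq r 0.
        by rewrite invr0 !scale0r !mul0mx mul0r !dotpE !addr0.
      rewrite scalerA mulfV// scale1r [z s + _]addrC subrK.
      by rewrite -scalemxAl mulmxBl !dotpE; ring.
    apply: cvgD; last by apply: cvg_dotp => //; exact: cvg_cst.
    apply: cvg_dotp; first exact: cvg_mulmxr.
    rewrite -[X in _ --> X]addr0 -(scale0r (y *m M)).
    apply: cvgD; first exact: cvg_cst.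
    by apply: (@cvgZ _ _ _ _ _ id) => //; exact: cvg_within.
(* [G] is [P *m B] times its own transpose, so the form is the squared norm of [z T *m P *m B]. *)
have zPB : z T *m P *m B = 0.
  apply: dotp_eq0; apply/eqP; rewrite eq_le dotp_ge0 andbT; apply: le_trans zG0.
  by rewrite /G MB !mulmxA [leRHS]dotp_mulmx trmxK [leRHS]dotpC dotp_mulmx.
by rewrite (zspan _ T0) /G MB !mulmxA zPB !mul0mx.
Qed.

End Uniqueness.

(** * Existence and selection of the primal variable *)

Section FactorizedFlow.
Set Implicit Arguments.
Unset Strict Implicit.
Context {R : realType} {d : nat}.
Local Notation V := 'rV[R]_d.
Local Notation mu := (@lebesgue_measure R).
Variables (M B : 'M[R]_d) (p : V) (c : R) (h : V -> \bar R) (w0 : V).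
Hypothesis (MB : M = B *m B^T).

(* With w = w0 + u *m B^T, the mirror flow reads - u' = (x - p) *m B with
   w in subdiff h x, that is - u' in flow_op (subdiff h^* ) u. *)
Definition flow_op (S : V -> set V) (u v : V) : Prop :=
  exists2 x, S (w0 + u *m B^T) x & v = (x - p) *m B.

Let dual_op : V -> V -> Prop := flow_op (subdiff (fenchel h)).
Let primal_op : V -> V -> Prop := flow_op (fun w x => subdiff h x w).

Lemma quad_loss_factor x : quad_loss M (p *m M) c x =
  2^-1 * (enorm ((x - p) *m B) ^+ 2 - enorm (p *m B) ^+ 2) + c.
Proof.
have ME (y z : V) : dotp y (z *m M) = dotp (y *m B) (z *m B).
  by rewrite dotp_mulmx MB mulmxA.
have MT : M^T = M by rewrite MB trmx_mul trmxK.
rewrite /quad_loss /mxapp MT !enorm_sqr mulmxBl (dotpC (p *m M)) !ME.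
rewrite !dotpE (dotpC (p *m B) (x *m B)); lra.
Qed.

Hypotheses (hh : Gamma0 h).

Let ph : proper_fun h. Proof. by case: hh. Qed.

Lemma primal_dual_op u v : primal_op u v -> dual_op u v.
Proof. by move=> [x hx ->]; exists x => //; exact: subdiff_fenchel. Qed.

Variables (a b : V).
Hypotheses (ria : relint (edom (fenchel h)) a) (w0E : w0 = a + b *m M).

Lemma dual_op_monotone : monotone_op dual_op.
Proof.
have pf : proper_fun (fenchel h).
  by apply: proper_fenchel => //; exists a; case: ria.
move=> u1 _ u2 _ [x1 S1 ->] [x2 S2 ->].
rewrite -mulmxBl dotp_mulmx mulmxBl opprB addrA subrK.
have := subdiff_monotone pf S1 S2.
by rewrite opprD addrACA subrr add0r.
Qed.

(** Substituting [w0 = a + b *m M] turns the resolvent equation into that of [constrained_resolvent]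
    based at the relative interior point [a]: the offset [b *m M] is absorbed in [g], being in the
    range of [B^T]. *)
Lemma primal_op_resolvable : resolvable primal_op.
Proof.
move=> k u k0.
have [x hx] := constrained_resolvent B (b *m B + u + k *: (p *m B)) hh ria k0.
exists (u - k *: ((x - p) *m B)), ((x - p) *m B); split; last by rewrite subrK.
exists x => //; move: hx; congr (subdiff h x _).
rewrite w0E MB -[RHS]addrA; congr (a + _); rewrite mulmxA -mulmxDl; congr (_ *m _).
by rewrite mulmxBl; apply/rowP => i; rewrite !mxE; ring.
Qed.

Lemma dual_op_resolvable : resolvable dual_op.
Proof.
move=> k u k0; have [z [v [Hv zE]]] := primal_op_resolvable u k0.
by exists z, v; split=> //; exact: primal_dual_op.
Qed.

(* Both operators are maximal monotone; this replaces Fenchel-Moreau. *)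
Lemma dual_primal_op u v : dual_op u v -> primal_op u v.
Proof.
move=> uv; apply: monotone_maximal; first exact: primal_op_resolvable.
by move=> y w /primal_dual_op yw; exact: dual_op_monotone.
Qed.

(** The derivative of [w] only determines [v *m B^T]; since [v] and [(x - p) *m B] both lie in the
    range of [B], where [B^T] is injective, it determines [(x - p) *m B] as well. *)
Lemma primal_variable_argmin u x v : least_norm_at dual_op u v ->
  v *m B^T = (x - p) *m M -> subdiff h x (w0 + u *m B^T) ->
  argmin_on (subdiff (fenchel h) (w0 + u *m B^T)) (quad_loss M (p *m M) c) x.
Proof.
move=> [[x1 _ vE] minv] vB hx.
have {}vE : v = (x - p) *m B.
  apply/subr0_eq/dotp_eq0; rewrite [X in dotp X _](_ : _ = (x1 - x) *m B).
    by rewrite dotp_mulmx mulmxBl vB MB mulmxA subrr dotp0r.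
  by rewrite vE -mulmxBl; congr (_ *m _); apply/rowP => i; rewrite !mxE; ring.
split=> [|y hy]; first exact: subdiff_fenchel.
have : enorm ((x - p) *m B) <= enorm ((y - p) *m B).
  by rewrite -vE; apply: minv; exists y.
rewrite !quad_loss_factor enorm_le ?enorm_ge0// -!enorm_sqr; lra.
Qed.

Lemma factorized_flow : dom_subdiff (fenchel h) w0 ->
  exists w : R -> V,
    [/\ lipschitz_mirror_flow_from h (quad_loss M (p *m M) c) w0 w,
        forall w' : R -> V,
          lipschitz_mirror_flow_from h (quad_loss M (p *m M) c) w0 w' ->
          forall t : R, 0 <= t -> w' t = w t
      & forall x : R -> V,
          primal_variable h (quad_loss M (p *m M) c) w x ->
          \forall t \ae mu, 0 <= t ->
            argmin_on (subdiff (fenchel h) (w t)) (quad_loss M (p *m M) c) (x t)].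
Proof.
move=> [x0 hx0].
have MT : M^T = M by rewrite MB trmx_mul trmxK.
have dual0 : dual_op 0 ((x0 - p) *m B) by exists x0 => //; rewrite mul0mx addr0.
have [u [u0 u_lip [D cD u_der]]] :=
  monotone_flow dual_op_monotone dual_op_resolvable dual0.
pose w t : V := w0 + u t *m B^T.
have w_der t (v : V) : r^-1 *: (u (t + r) - u t) @[r --> (0 : R)^'] --> - v ->
    derivable w t 1 /\ derive1 w t = - (v *m B^T).
  move=> uv; apply: quotient_derive1.
  have -> : (fun r : R => r^-1 *: (w (r + t) - w t)) =
      fun r : R => (r^-1 *: (u (t + r) - u t)) *m B^T.
    apply/funext => r; rewrite -scalemxAl mulmxBl /w (addrC r); congr (_ *: _).
    by rewrite opprD addrACA subrr add0r.
  by rewrite -mulNmx; exact: cvg_mulmxr.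
(* Time 0 joins the null set because the derivative is two-sided. *)
have ae_pos : \forall t \ae mu, 0 <= t -> 0 < t /\ ~ D t.
  have nD : mu.-negligible (D `|` [set 0]).
    apply: negligibleU.
      exists D; split=> //; last exact: countable_lebesgue_measure0.
      exact: countable_measurable.
    exists [set 0]; split=> //; exact: lebesgue_measure_set1.
  apply: negligibleS nD => t /= /not_implyP[t0 /not_andP[tn|/contrapT]];
    last by left.
  by right; apply/eqP; rewrite eq_le t0 leNgt andbT; apply/negP.
have ae_der : \forall t \ae mu, 0 <= t -> exists2 v, least_norm_at dual_op (u t) v &
    derivable w t 1 /\ derive1 w t = - (v *m B^T).
  move: ae_pos; apply: lebesgue_aeS => t /[apply] -[t0 nDt].
  have [v minv uv] := u_der t t0 nDt; exists v => //; exact: w_der.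
have flow_w : lipschitz_mirror_flow_from h (quad_loss M (p *m M) c) w0 w.
  split; last by rewrite /w u0 mul0mx addr0.
    apply/lipschitz_half_line.
    have [C C0 HC] := enorm_mulmx_bound B^T.
    exists (C * enorm ((x0 - p) *m B)); first by rewrite mulr_ge0 ?enorm_ge0.
    move=> s t s0 st; apply: le_trans (norm_le_enorm _) _.
    rewrite /w opprD addrACA subrr add0r -mulmxBl.
    apply: le_trans (HC _) _; rewrite -mulrA ler_wpM2l// mulrC.
    exact: u_lip.
  (* The least-norm element comes from the dual operator; equality with the primal one yields an [x]
     that has [w t] as a subgradient of [h]. Times without a least-norm element get 0 and are
     negligible. *)
  have /choice[x xP] : forall t, exists x, forall v,
      least_norm_at dual_op (u t) v -> subdiff h x (w t) /\ v = (x - p) *m B.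
    move=> t.
    have [[v minv]|nex] := pselect (exists v, least_norm_at dual_op (u t) v).
      have [x hx vE] := dual_primal_op minv.1; exists x => v' minv'.
      by rewrite (least_norm_unique dual_op_monotone dual_op_resolvable minv' minv).
    by exists 0 => v minv; case: nex; exists v.
  exists x; rewrite /primal_variable.
  move: ae_der; apply: lebesgue_aeS => t /[apply] -[v minv [dw ->]].
  have [hx ->] := xP _ _ minv; split=> //.
  by rewrite gradient_quad_loss// -mulmxBl MB mulmxA.
exists w; split=> //.
  move=> w' flow_w'.
  have MPM : M *m pinvmx M *m M = M by exact: mulmxKpV.
  exact: (mirror_flow_unique MB MPM ph flow_w' flow_w).
move=> x; rewrite /primal_variable => primal_x.
move: ae_der primal_x; apply: lebesgue_aeS2 => t der_t primal_t t0.
have [v minv [_ dwE]] := der_t t0; have [_ dwE' hx] := primal_t t0.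
apply: (primal_variable_argmin minv) => //.
move: dwE'; rewrite dwE gradient_quad_loss// => /oppr_inj ->.
by rewrite mulmxBl.
Qed.

End FactorizedFlow.

Theorem theorem3p5 (R : realType) (d : nat) (hd : (0 < d)%N)
    (M : 'M[R]_d) (q : 'rV[R]_d) (c : R)
    (hM : sym_psd M) (hq : colspan M q)
    (h : 'rV[R]_d -> \bar R) (hh : Gamma0 h) (hdom : closed (edom h))
    (w0 : 'rV[R]_d) (hw0 : dom_subdiff (fenchel h) w0)
    (hw0' : [set a + b | a in relint (edom (fenchel h)) & b in colspan M] w0) :
  exists w : R -> 'rV[R]_d,
    [/\ lipschitz_mirror_flow_from h (quad_loss M q c) w0 w,
        forall w' : R -> 'rV[R]_d,
          lipschitz_mirror_flow_from h (quad_loss M q c) w0 w' ->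
          forall t : R, 0 <= t -> w' t = w t
      & forall x : R -> 'rV[R]_d,
          primal_variable h (quad_loss M q c) w x ->
          \forall t \ae (@lebesgue_measure R), 0 <= t ->
            argmin_on (subdiff (fenchel h) (w t)) (quad_loss M q c) (x t)].
Proof.
have [MT psd] := hM; rewrite /mxapp MT in psd.
have [B MB] := psd_factorization MT psd.
have [p _ pq] := hq; have [a ria [_ [b _ <-] w0E]] := hw0'.
rewrite /mxapp MT in pq w0E; rewrite -pq.
exact: (factorized_flow _ _ MB hh ria (esym w0E) hw0).
Qed.
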